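(* Every genus $3$ hyperelliptic curve with full automorphism group isomorphic to $D_{12}$ has equation $$Y^2=X\,(tX^6+tX^3+1)$$ for $t\neq 0,4$. If $t\neq \frac{35}{2},\,-\frac{245}{4}$, then $$t=\frac72\,\frac{5t_4+7}{t_4-4}$$ in terms of the absolute invariants, and therefore the field of moduli is a field of definition.
   Context: Curves are over an algebraically closed field $k$ of characteristic zero; $D_{12}$ is the dihedral group of order $12$. For a binary octavic $f$, let $(\cdot,\cdot)^n$ be the classically normalized $n$-th transvection, and put $\kappa=(f,f)^6$, $h=(\kappa,\kappa)^2$, $J_2=2^2\cdot5\cdot7\,(f,f)^8$, $J_4=2^9\cdot3\cdot7^4\,(\kappa,\kappa)^4$, $J_6=2^{14}\cdot3^2\cdot7^6\,(\kappa,h)^4$. The absolute invariant $t_4$ of a curve $Y^2=F(X)$ is $t_4=J_6/(J_2J_4)$, evaluated at the degree $8$ homogenization of $F$. The field of moduli of a curve is the field of rationality of its moduli point (generated by its absolute invariants); a field of definition is a field over which some curve isomorphic to it has an equation. *)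

(* Defs.v *)
From mathcomp Require Export all_boot all_order all_fingroup all_algebra.
From mathcomp Require Export all_solvable all_field.
From mathcomp Require Export mpoly.

Set Implicit Arguments.
Unset Strict Implicit.
Unset Printing Implicit Defensive.

Import GRing.Theory.

Local Open Scope ring_scope.

(* A curve over the algebraically closed field k is given by its function
   field: a field K together with the embedding iota : k -> K of the constants.
   Isomorphic curves are those with k-isomorphic function fields, so "some curve
   isomorphic to C has equation P = 0" means that K is the function field of
   the affine plane curve P = 0. *)
Section Curves.

Variables (k K : fieldType) (iota : {rmorphism k -> K}).

Definition eval_at (x y : K) (P : {poly {poly k}}) : K :=
  (map_poly (map_poly iota) P).[x, y].

(* K = k(x, y), and the ideal of algebraic relations between x and y over k is
   generated by P. *)
Definition has_equation (P : {poly {poly k}}) : Prop :=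
  exists x y : K,
    (forall z : K, exists A B : {poly {poly k}},
       eval_at x y B != 0 /\ z = eval_at x y A / eval_at x y B) /\
    (forall Q : {poly {poly k}},
       eval_at x y Q = 0 <-> exists R : {poly {poly k}}, Q = R * P).

(* Y^2 = F(X) *)
Definition double_cover (F : {poly k}) : {poly {poly k}} := 'Y ^+ 2 - F^:P.

(* In characteristic different from 2, Y^2 = F(X) has genus g >= 2 when F is
   squarefree of degree 2g + 1 or 2g + 2. *)
Definition genus3_model (F : {poly k}) : Prop :=
  [/\ separable_poly F, (size F == 8) || (size F == 9)
    & has_equation (double_cover F)].

Definition genus3_hyperelliptic : Prop := exists F : {poly k}, genus3_model F.

(* Automorphisms of the curve are those of K over k; reversing the order of
   composition does not affect the isomorphism class of the group. *)
Definition is_automorphism (s : K -> K) : Prop :=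
  [/\ bijective s,
      forall u v : K, s (u + v) = s u + s v,
      forall u v : K, s (u * v) = s u * s v
    & forall c : k, s (iota c) = iota c].

Definition full_automorphism_group (gT : finGroupType) : Prop :=
  exists phi : gT -> (K -> K),
    [/\ forall a : gT, is_automorphism (phi a),
        forall s : K -> K, is_automorphism s -> exists a : gT, s =1 phi a,
        forall a b : gT, phi a =1 phi b -> a = b
      & forall a b : gT, phi (a * b)%g =1 phi a \o phi b].

End Curves.

Section BinaryForms.

Variable k : fieldType.

Implicit Types f g : {mpoly k[2]}.

Definition formX : 'I_2 := ord0.
Definition formZ : 'I_2 := ord_max.

Definition pderiv (a b : nat) (f : {mpoly k[2]}) : {mpoly k[2]} :=
  f^`M(formX, a)^`M(formZ, b).

(* n-th transvectant of f and g, of respective degrees m and p, with the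
   classical normalization. *)
Definition transvectant (m p n : nat) (f g : {mpoly k[2]}) : {mpoly k[2]} :=
  (((m - n)`! * (p - n)`!)%:R / (m`! * p`!)%:R) *:
    \sum_(j < n.+1) ((-1) ^+ j * 'C(n, j)%:R) *:
      (pderiv (n - j) j f * pderiv j (n - j) g).

Definition octavic_of_poly (F : {poly k}) : {mpoly k[2]} :=
  \sum_(i < 9) F`_i *: ('X_formX ^+ i * 'X_formZ ^+ (8 - i)).

Definition cov_kappa (f : {mpoly k[2]}) := transvectant 8 8 6 f f.
Definition cov_h (f : {mpoly k[2]}) :=
  transvectant 4 4 2 (cov_kappa f) (cov_kappa f).

(* The transvectants below have degree 0; the scalar is their constant term. *)
Definition J2 (f : {mpoly k[2]}) : k :=
  (2 ^ 2 * 5 * 7)%:R * (transvectant 8 8 8 f f)@_0%MM.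
Definition J4 (f : {mpoly k[2]}) : k :=
  (2 ^ 9 * 3 * 7 ^ 4)%:R *
    (transvectant 4 4 4 (cov_kappa f) (cov_kappa f))@_0%MM.
Definition J6 (f : {mpoly k[2]}) : k :=
  (2 ^ 14 * 3 ^ 2 * 7 ^ 6)%:R *
    (transvectant 4 4 4 (cov_kappa f) (cov_h f))@_0%MM.

Definition t4_inv (f : {mpoly k[2]}) : k := J6 f / (J2 f * J4 f).

Definition linear_subst (M : 'M[k]_2) (f : {mpoly k[2]}) : {mpoly k[2]} :=
  f \mPo [tuple M i formX *: 'X_formX + M i formZ *: 'X_formZ | i < 2].

Definition octavic_coef (f : {mpoly k[2]}) (i : 'I_9) : k :=
  f@_[multinom [tuple (i : nat); (8 - i)%N]].

Definition octavic_eval (I : {mpoly int[9]}) (f : {mpoly k[2]}) : k :=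
  mmap (intmul 1) (octavic_coef f) I.

(* Homogeneous SL_2-invariants of degree d of binary octavics. Integer
   coefficients lose nothing with respect to rational ones, as only quotients
   of invariants of equal degree are used. *)
Definition octavic_invariant (d : nat) (I : {mpoly int[9]}) : Prop :=
  I \is d.-homog /\
  forall (M : 'M[k]_2) (f : {mpoly k[2]}),
    \det M = 1 -> f \is 8.-homog ->
    octavic_eval I (linear_subst M f) = octavic_eval I f.

End BinaryForms.

Section FieldOfModuli.

Variables (k K : fieldType) (iota : {rmorphism k -> K}).

Definition is_subfield (S : k -> Prop) : Prop :=
  [/\ S 1, forall a b : k, S a -> S b -> S (a - b),
      forall a b : k, S a -> S b -> S (a * b)
    & forall a : k, S a -> S a^-1].

Definition absolute_invariant_value (v : k) : Prop :=
  exists (F : {poly k}) (d : nat) (I J : {mpoly int[9]}),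
    [/\ genus3_model iota F,
        octavic_invariant k d I, octavic_invariant k d J,
        octavic_eval J (octavic_of_poly F) != 0
      & v = octavic_eval I (octavic_of_poly F)
            / octavic_eval J (octavic_of_poly F)].

(* The subfield of k generated by the absolute invariants of the curve, i.e.
   the residue field of its point on the moduli space of genus 3 hyperelliptic
   curves over the rationals. *)
Definition field_of_moduli (z : k) : Prop :=
  forall S : k -> Prop, is_subfield S ->
    (forall v : k, absolute_invariant_value v -> S v) -> S z.

Definition field_of_definition (S : k -> Prop) : Prop :=
  is_subfield S /\
  exists P : {poly {poly k}},
    (forall i j : nat, S P`_i`_j) /\ has_equation iota P.

End FieldOfModuli.

(* Main.v *)
Require Import Defs.
From HB Require Import structures.
From mathcomp Require Import ring zify.
Import GRing.Theory.
Local Open Scope ring_scope.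
Set Implicit Arguments.
Unset Strict Implicit.
Unset Printing Implicit Defensive.

(** The curve is handled through its function field K. A model is a pair of
generators x, y of K with y^2 = F(x), and the heart of the matter is that two
models of K differ by a Moebius transformation of the first generator. Indeed
K has degree 2 over k(x) and over k(u), so the first generators x and u satisfy
a relation of bidegree (2, 2) (bidegree, a form of Gauss's lemma). If u
were not a function of x alone, completing the square in this relation would
give K = k(x, sqrt D) with D of degree at most 4; then F D would be a square in
k(x), which the seven or more simple roots of F forbid (no_small_branch). Once
u is rational in x and x in u, a relation of bidegree (1, 1) makes u a Moebius
function of x (moebius). Comparing the two expressions of y modulo squares once
more shows that the octavic forms of the two models agree up to the change of
variables and a constant (model_transport). In particular an automorphism of
the curve is a Moebius transformation that preserves the octavic form.

In the dihedral group of order 12 there are an element of order 3 and an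
element that inverts it. In a suitable coordinate w they act by w -> om w, with
om a primitive cube root of unity, and by w -> 1/w (normal_coordinate). An
octavic form which both preserve is a X^7 + b X^4 + c X up to homogenization,
with c = a as soon as b is nonzero (normal_shape). If b = 0 there is an
automorphism (w, v) -> (n^2 w, n v) with n^6 = -1, of order 12, while the
exponent of the group is 6 (no_order12). Otherwise rescaling w and v gives the
equation of the theorem, with t = (b / a)^2. The form is squarefree
(model_squarefree), which excludes t = 4, where it is X (2 X^3 + 1)^2.

The transvectants commute with linear substitutions up to a power of the
determinant (omega_subst), so t4 takes the same value on all models. On the
family, J2 = t (2 t - 35), J4 = t^2 (8 t + 49)^2 and J6 = t^3 (8 t + 49)^3, so
t4 = (8 t + 49) / (2 t - 35), and solving for t gives the formula. At
t = - 49 / 8, where J4 vanishes, the roots of the octavic form are the vertices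
of a cube; the curve then has an automorphism that induces a rotation of
order 4, which the exponent of the group forbids (no_cube). Finally t4 is,
up to a rational factor, the quotient of two invariants with integer
coefficients, so t lies in the field of moduli, and so do the coefficients of
the equation. *)

Section CharacteristicZero.
Variable F : fieldType.
Hypothesis char0 : [pchar F] =i pred0.

Lemma natr_neq0 n : n.+1%:R != 0 :> F.
Proof. by have /pcharf0P-> := char0. Qed.

Lemma natk_neq0 n : (0 < n)%N -> n%:R != 0 :> F.
Proof. by case: n => // n _; apply: natr_neq0. Qed.

End CharacteristicZero.

(** * Plane models of the function field *)

Section Gauss.
Variable k : closedFieldType.
Implicit Types (P Q M S : {poly {poly k}}) (c : {poly k}).

Lemma map_horner_eq0 (al : k) P :
  map_poly (horner_eval al) P = 0 -> exists P', P = ('X - al%:P) *: P'.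
Proof.
move=> P0; exists (map_poly (fun c => c %/ ('X - al%:P)) P).
apply/polyP=> i; rewrite coefZ coef_map_id0 ?div0p // mulrC divpK //.
by rewrite dvdp_XsubCl; apply/rootP; move/polyP/(_ i): P0; rewrite coef_map coef0.
Qed.

(** Gauss's lemma by specialization: at a root of c the product M S vanishes, so
one factor is divisible by the corresponding linear polynomial in the inner
variable, and the degree of c drops. *)
Lemma gauss_dvd c P M S : c != 0 -> c *: P = M * S ->
  exists c' M' S', [/\ c' != 0, M = c' *: M' & P = M' * S'].
Proof.
elim: {c}(size c) {-2}c (leqnn (size c)) M S => [|n IH] c.
  by rewrite size_poly_leq0 => /eqP-> M S; rewrite eqxx.
move=> szc M S c0 E.
have [/size_poly1P[a a0 cE]|/closed_rootP[al]] := boolP (size c == 1%N).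
  exists 1, M, (a^-1%:P *: S); split; rewrite ?oner_neq0 ?scale1r //.
  by rewrite -scalerAr -E cE scalerA -polyCM mulVf // scale1r.
case/factor_theorem=> c1 cE.
have c10 : c1 != 0 by apply: contraNneq c0 => c10; rewrite cE c10 mul0r.
have szc1 : (size c1 <= n)%N.
  by move: szc; rewrite cE size_mul ?polyXsubC_eq0 ?size_XsubC ?addn2.
have X0 : 'X - al%:P != 0 :> {poly k} by rewrite polyXsubC_eq0.
have canc P1 P2 : ('X - al%:P) *: P1 = ('X - al%:P) *: P2 -> P1 = P2.
  move=> /(congr1 (fun P => P)); rewrite -!mul_polyC; apply: mulfI.
  by rewrite polyC_eq0.
have /(congr1 (map_poly (horner_eval al))) := E.
rewrite linearZ rmorphM /= {1}/horner_eval cE hornerM hornerXsubC subrr mulr0.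
rewrite scale0r => /esym/eqP; rewrite mulf_eq0 => /orP[] /eqP /map_horner_eq0 [Q QE].
- have {}E : c1 *: P = Q * S.
    by apply: canc; rewrite scalerA mulrC -cE E QE scalerAl.
  have [c' [M' [S' [c'0 ME PE]]]] := IH _ szc1 _ _ c10 E.
  exists (('X - al%:P) * c'), M', S'; split=> //; first by rewrite mulf_neq0.
  by rewrite QE ME scalerA.
- have {}E : c1 *: P = M * Q.
    by apply: canc; rewrite scalerA mulrC -cE E QE scalerAr.
  exact: IH _ szc1 _ _ c10 E.
Qed.
End Gauss.

Section Eval.
Variables (k : closedFieldType) (K : fieldType) (iota : {rmorphism k -> K}).

Definition evalk (x : K) (p : {poly k}) : K := (map_poly iota p).[x].
HB.instance Definition _ x := GRing.RMorphism.copy (evalk x) (horner_eval x \o map_poly iota).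
Local Notation ev := evalk.

Lemma evC x c : ev x c%:P = iota c.
Proof. by rewrite /evalk map_polyC hornerC. Qed.
Lemma evX x : ev x 'X = x.
Proof. by rewrite /evalk map_polyX hornerX. Qed.
Lemma evZ x c p : ev x (c *: p) = iota c * ev x p.
Proof. by rewrite -mul_polyC rmorphM /= evC. Qed.

HB.instance Definition _ x y :=
  GRing.RMorphism.copy (eval_at iota x y)
    (horner_eval y \o (horner_eval x%:P \o map_poly (map_poly iota))).

Lemma eval_atC x y c : eval_at iota x y c%:P = ev y c.
Proof. by rewrite /eval_at map_polyC hornerC. Qed.

Lemma eval_at_swap x y P : eval_at iota x y (swapXY P) = eval_at iota y x P.
Proof. by rewrite /eval_at -swapXY_map horner2_swapXY. Qed.

Lemma eval_at_mapC x y c : eval_at iota x y c^:P = ev x c.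
Proof. by rewrite -swapXY_polyC eval_at_swap eval_atC. Qed.

Lemma eval_atZ x y c P : eval_at iota x y (c *: P) = ev y c * eval_at iota x y P.
Proof. by rewrite -mul_polyC rmorphM /= eval_atC. Qed.

Definition transcendental (x : K) := forall p : {poly k}, ev x p = 0 -> p = 0.

(** The degrees over k(u) and over k(x) bound the two degrees of one and the same
relation. Among the relations found by pseudo-division, one of least degree
in x divides the others over k(u), hence, once its content is removed, over
k[u]; it therefore inherits their degree in u. *)
Lemma bidegree x u m n (P Q : {poly {poly k}}) :
    transcendental u ->
    P != 0 -> (size P <= m)%N -> eval_at iota x u P = 0 ->
    Q != 0 -> (size Q <= n)%N -> eval_at iota u x Q = 0 ->
  exists R : {poly {poly k}},
    [/\ R != 0, (size R <= m)%N, (size (swapXY R) <= n)%N & eval_at iota x u R = 0].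
Proof.
move=> tru; elim: {P}(size P) {-2}P (leqnn (size P)) => [|N IH] P szP.
  by move: szP; rewrite size_poly_leq0 => /eqP->; rewrite eqxx.
move=> P0 Pm Pxu Q0 Qn Qux.
have Qxu : eval_at iota x u (swapXY Q) = 0 by rewrite eval_at_swap.
have E := Pdiv.Idomain.divp_eq (swapXY Q) P.
have [rem0|rem0] := eqVneq (swapXY Q %% P) 0; last first.
  have lt_rem : (size (swapXY Q %% P)%R < size P)%N by rewrite ltn_modp.
  apply: (IH (swapXY Q %% P)) => //; first by rewrite -ltnS (leq_trans lt_rem).
    by rewrite (leq_trans (ltnW lt_rem)).
  move/(congr1 (eval_at iota x u)): E.
  by rewrite eval_atZ Qxu mulr0 rmorphD rmorphM /= Pxu mulr0 add0r.
have c0 : lead_coef P ^+ scalp (swapXY Q) P != 0 by rewrite expf_neq0 // lead_coef_eq0.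
move: E; rewrite rem0 addr0 mulrC => /(gauss_dvd c0) [c' [P' [S [c'0 PE QE]]]].
have P'0 : P' != 0 by apply: contraNneq P0; rewrite PE => ->; rewrite scaler0.
have S0 : S != 0.
  by apply: contraNneq Q0 => S0; rewrite -swapXY_eq0 QE S0 mulr0.
exists P'; split=> //.
- by move: Pm; rewrite PE size_scale.
- apply: leq_trans Qn; rewrite -(swapXYK Q) QE rmorphM /=.
  by rewrite size_mul ?swapXY_eq0 // (polySpred (p := swapXY S)) ?swapXY_eq0 // addnS leq_addr.
- move: Pxu; rewrite PE eval_atZ => /eqP; rewrite mulf_eq0 => /orP[/eqP/tru c'E|/eqP//].
  by rewrite c'E eqxx in c'0.
Qed.

Lemma eval_at_sum n x y (P : {poly {poly k}}) : (size P <= n)%N ->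
  eval_at iota x y P = \sum_(i < n) ev y P`_i * x ^+ i.
Proof.
move=> szP; have sz' : (size (map_poly (map_poly iota) P) <= n)%N.
  exact: leq_trans (size_poly _ _) szP.
rewrite /eval_at (horner_coef_wide _ sz') horner_sum; apply: eq_bigr => i _.
by rewrite coef_map -polyC_exp hornerM hornerC.
Qed.

(** The basis 1, y of K over k(x) makes the ring of functions explicit; on this
form of the hypothesis that K is the function field of y^2 = F(x) one can
compute. *)
Definition is_model (x y : K) (F : {poly k}) : Prop :=
  [/\ y ^+ 2 = ev x F,
      forall A B, ev x A + ev x B * y = 0 -> A = 0 /\ B = 0
    & forall z, exists A B C, C != 0 /\ z = (ev x A + ev x B * y) / ev x C].

Lemma eval_double_cover x y F : eval_at iota x y (double_cover F) = y ^+ 2 - ev x F.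
Proof. by rewrite /double_cover rmorphB rmorphXn /= eval_atC evX eval_at_mapC. Qed.

Lemma swap_double_cover (F : {poly k}) :
  swapXY ('X^2 - F%:P : {poly {poly k}}) = double_cover F.
Proof.
rewrite /double_cover raddfB /= swapXY_polyC; congr (_ - _).
by rewrite !expr2 rmorphM /= swapXY_X.
Qed.

(** Division by Y^2 - F, which is monic in the inner variable. *)
Lemma double_cover_mod F (Q : {poly {poly k}}) :
  exists A B R, Q = A^:P + B^:P * 'Y + R * double_cover F.
Proof.
pose D : {poly {poly k}} := 'X^2 - F%:P.
have DE : swapXY D = double_cover F by exact: swap_double_cover.
have szD : size D = 3 by rewrite size_XnsubC.
have monD : D \is monic by rewrite monicXnsubC.
have := Pdiv.RingMonic.rdivp_eq monD (swapXY Q).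
set S := Pdiv.Ring.rdivp _ _; set r := Pdiv.Ring.rmodp _ _ => E.
have szr : (size r <= 2)%N.
  by rewrite -ltnS -[X in (_ < X)%N]szD Pdiv.Ring.ltn_rmodpN0 ?monic_neq0.
exists r`_0, r`_1, (swapXY S); rewrite -DE -rmorphM -(swapXYK Q) E rmorphD /= addrC.
congr (_ + _).
suff -> : r = (r`_0)%:P + (r`_1)%:P * 'X.
  by rewrite rmorphD rmorphM /= !swapXY_polyC swapXY_X !coefD !coefCM !coefC !coefX /= !(mulr0, mulr1, add0r, addr0).
apply/polyP=> i; rewrite coefD coefCM coefC coefX.
case: i => [|[|i]] /=; rewrite ?(mulr0, mulr1, add0r, addr0) //.
by rewrite nth_default // (leq_trans szr).
Qed.

Lemma double_cover_free F A B R :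
  A^:P + B^:P * 'Y = R * double_cover F :> {poly {poly k}} -> A = 0 /\ B = 0.
Proof.
pose D : {poly {poly k}} := 'X^2 - F%:P.
have DE : double_cover F = swapXY D by rewrite -swap_double_cover.
have szD : size D = 3 by rewrite size_XnsubC.
move=> /(congr1 (@swapXY k)); rewrite DE rmorphD !rmorphM /= swapXY_Y !swapXY_map_polyC swapXYK.
move=> E; have sz2 : (size (A%:P + B%:P * 'X : {poly {poly k}})%R <= 2)%N.
  rewrite (leq_trans (size_polyD _ _)) // geq_max.
  rewrite (leq_trans (size_polyC_leq1 _)) // mul_polyC.
  by rewrite (leq_trans (size_scale_leq _ _)) // size_polyX.
have R0 : swapXY R = 0.
  apply: contraTeq sz2 => R0; rewrite -ltnNge E size_mul ?R0 //; last first.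
    by rewrite monic_neq0 ?monicXnsubC.
  by rewrite szD addn3 /= ltnS ltnS size_poly_gt0.
move: E; rewrite R0 mul0r => /polyP E.
have := E 0; have := E 1; rewrite !coefD !coefCM !coefC !coefX /=.
by rewrite mulr0 mulr1 add0r addr0 => -> ->.
Qed.

Lemma model_of_equation F :
  has_equation iota (double_cover F) -> exists x y, is_model x y F.
Proof.
case=> x [y [gen rel]]; exists x, y.
have y2 : y ^+ 2 = ev x F.
  apply/eqP; rewrite -subr_eq0 -eval_double_cover; apply/eqP/rel.
  by exists 1; rewrite mul1r.
have free A B : ev x A + ev x B * y = 0 -> A = 0 /\ B = 0.
  move=> E; have /rel[R] : eval_at iota x y (A^:P + B^:P * 'Y) = 0.
    by rewrite rmorphD rmorphM /= !eval_at_mapC eval_atC evX.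
  exact: double_cover_free.
have evalE Q : exists A B, eval_at iota x y Q = ev x A + ev x B * y.
  have [A [B [R ->]]] := double_cover_mod F Q; exists A, B.
  rewrite !rmorphD !rmorphM /= !eval_at_mapC eval_atC evX eval_double_cover y2.
  by rewrite subrr mulr0 addr0.
split=> // z; have [P [Q [Q0 ->]]] := gen z.
have [A [B EA]] := evalE P; have [C [D ED]] := evalE Q.
rewrite EA; rewrite ED in Q0 *.
have N0 : C ^+ 2 - D ^+ 2 * F != 0.
  apply: contraNneq Q0 => N0.
  have : (ev x C + ev x D * y) * (ev x C + ev x (- D) * y) = 0.
    transitivity (ev x (C ^+ 2 - D ^+ 2 * F)); last by rewrite N0 rmorph0.
    by rewrite !(rmorphN, rmorphB, rmorphM, rmorphXn) /= -y2; ring.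
  move/eqP; rewrite mulf_eq0 => /orP[//|/eqP/free[C0 /eqP]].
  by rewrite oppr_eq0 => /eqP D0; rewrite C0 D0 !rmorph0 mul0r addr0.
exists (A * C - B * D * F), (B * C - A * D), (C ^+ 2 - D ^+ 2 * F); split=> //.
have evN0 : ev x (C ^+ 2 - D ^+ 2 * F) != 0.
  apply: contraNneq N0 => E; have [-> //] : C ^+ 2 - D ^+ 2 * F = 0 /\ (0 : {poly k}) = 0.
  by apply: free; rewrite E rmorph0 mul0r addr0.
move: evN0; rewrite !(rmorphB, rmorphM, rmorphXn) /= -y2 => evN0.
by field; rewrite evN0 Q0.
Qed.

Lemma equation_of_model x y F : is_model x y F -> has_equation iota (double_cover F).
Proof.
case=> y2 free gen; exists x, y; split=> [z|Q].
  have [A [B [C [C0 ->]]]] := gen z; exists (A^:P + B^:P * 'Y), C^:P.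
  rewrite rmorphD rmorphM /= !eval_at_mapC eval_atC evX; split=> //.
  apply: contraNneq C0 => C0; have [-> //] : C = 0 /\ (0 : {poly k}) = 0.
  by apply: free; rewrite C0 rmorph0 mul0r addr0.
split=> [|[R ->]]; last by rewrite rmorphM /= eval_double_cover y2 subrr mulr0.
have [A [B [R ->]]] := double_cover_mod F Q.
rewrite !rmorphD !rmorphM /= !eval_at_mapC eval_atC evX eval_double_cover y2.
rewrite subrr mulr0 addr0 => /free[-> ->]; exists R.
by rewrite rmorph0 mul0r !add0r.
Qed.

End Eval.

(** * Uniqueness of the hyperelliptic projection *)

(** Each root of F is simple, so it occurs to an odd order in F B^2, hence in H. *)
Lemma squarefree_dvdp (k : closedFieldType) (F H B C : {poly k}) :
  separable_poly F -> B != 0 -> F * B ^+ 2 = H * C ^+ 2 -> F %| H.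
Proof.
move=> sepF B0 E; have F0 := separable_poly_neq0 sepF.
have : H * C ^+ 2 != 0 by rewrite -E mulf_neq0 ?expf_neq0.
rewrite mulf_eq0 negb_or => /andP[H0 C20].
have [r FE] := closed_field_poly_normal F.
have lF0 : lead_coef F != 0 by rewrite lead_coef_eq0.
have Ur : uniq r.
  by rewrite -separable_prod_XsubC; apply: dvdp_separable sepF; rewrite FE dvdpZr.
rewrite FE dvdpZl //; apply: uniq_roots_dvdp; last by rewrite uniq_rootsE.
apply/allP=> x xr; rewrite -dvdp_XsubCl XsubC_dvd //.
have mup2 (p : {poly k}) : p != 0 -> mup x (p ^+ 2) = (mup x p).*2.
  by move=> p0; rewrite expr2 mupM // addnn.
have C0 : C != 0 by move: C20; rewrite expf_eq0.
have P0 : \prod_(z <- r) ('X - z%:P) != 0 by rewrite monic_neq0 ?monic_prod_XsubC.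
have /(congr1 (mup x)) := E; rewrite (mupM x F0) ?expf_neq0 // (mupM x H0) ?expf_neq0 //.
rewrite !mup2 // FE -mul_polyC mupMr ?rootC // mu_prod_XsubC count_uniq_mem // xr.
by move/(congr1 odd); rewrite !oddD !odd_double !addbF; case: (mup x H).
Qed.

Section Uniqueness.
Variables (k : closedFieldType) (K : fieldType) (iota : {rmorphism k -> K}).
Local Notation ev := (evalk iota).
Local Notation is_model := (is_model iota).
Local Notation transcendental := (transcendental iota).
Implicit Types (A B C D F G H : {poly k}) (x y z u v w : K).

(** Membership in the subfield k(x) of K. *)
Definition rational_in (x z : K) := exists A C, C != 0 /\ z = ev x A / ev x C.

Local Notation rat := rational_in.

Lemma ev_neq0 x C : transcendental x -> C != 0 -> ev x C != 0.
Proof. by move=> tx; apply: contraNneq => /tx->. Qed.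

Lemma ev_inj x : transcendental x -> injective (ev x).
Proof. by move=> tx A B E; apply/eqP; rewrite -subr_eq0; apply/eqP/tx; rewrite rmorphB /= E subrr. Qed.

Section Rat.
Variable x : K.
Hypothesis tx : transcendental x.

Lemma rat_ev A : rat x (ev x A).
Proof. by exists A, 1; rewrite oner_neq0 rmorph1 divr1. Qed.

Lemma rat_iota a : rat x (iota a).
Proof. by rewrite -(evC iota x); apply: rat_ev. Qed.

Lemma ratD u v : rat x u -> rat x v -> rat x (u + v).
Proof.
move=> [A [C [C0 ->]]] [B [D [D0 ->]]]; exists (A * D + B * C), (C * D).
rewrite mulf_neq0 //; split=> //.
by rewrite rmorphD !rmorphM /= addf_div ?ev_neq0.
Qed.

Lemma ratM u v : rat x u -> rat x v -> rat x (u * v).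
Proof.
move=> [A [C [C0 ->]]] [B [D [D0 ->]]]; exists (A * B), (C * D).
by rewrite mulf_neq0 //; split=> //; rewrite !rmorphM /= mulf_div.
Qed.

Lemma ratV u : rat x u -> rat x u^-1.
Proof.
move=> [A [C [C0 ->]]]; have [->|A0] := eqVneq A 0.
  by rewrite rmorph0 mul0r invr0 -(rmorph0 iota); apply: rat_iota.
by exists C, A; rewrite invf_div.
Qed.

Lemma ratN u : rat x u -> rat x (- u).
Proof. by move=> ru; rewrite -mulN1r -(rmorphN1 iota); apply: ratM (rat_iota _) ru. Qed.

Lemma rat_trans u z : rat x u -> rat u z -> rat x z.
Proof.
move=> ru [A [C [_ ->]]].
have rp p : rat x (ev u p).
  elim/poly_ind: p => [|p c IH]; first by rewrite rmorph0 -(rmorph0 iota); apply: rat_iota.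
  by rewrite rmorphD rmorphM /= evX evC; apply: ratD (ratM IH ru) (rat_iota _).
exact: ratM (rp _) (ratV (rp _)).
Qed.

Lemma rat_id : rat x x.
Proof. by rewrite -{2}(evX iota x); apply: rat_ev. Qed.
End Rat.

Lemma size_lin (R : idomainType) (c0 c1 : R) : (size (c0%:P + c1%:P * 'X)%R <= 2)%N.
Proof.
rewrite (leq_trans (size_polyD _ _)) // geq_max.
rewrite (leq_trans (size_polyC_leq1 _)) // mul_polyC.
by rewrite (leq_trans (size_scale_leq _ _)) // size_polyX.
Qed.

Lemma size_quad (R : idomainType) (c0 c1 c2 : R) :
  (size (c0%:P + c1%:P * 'X + c2%:P * 'X^2)%R <= 3)%N.
Proof.
rewrite (leq_trans (size_polyD _ _)) // geq_max (leq_trans (size_lin _ _)) // mul_polyC.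
by rewrite (leq_trans (size_scale_leq _ _)) // size_polyXn.
Qed.

Lemma ev_sum n x (p : {poly k}) : (size p <= n)%N ->
  ev x p = \sum_(i < n) iota p`_i * x ^+ i.
Proof.
move=> szp; rewrite /evalk (@horner_coef_wide _ n) ?size_map_poly //.
by apply: eq_bigr => i _; rewrite coef_map.
Qed.

(** Lueroth's theorem for a generator of the same subfield: the relation of
bidegree (1, 1) between x and u is linear in u, and its determinant is nonzero
since u is not constant. *)
Lemma moebius x u : transcendental x -> transcendental u -> rat x u -> rat u x ->
  exists a b c d, [/\ a * d - b * c != 0, iota c * x + iota d != 0
    & u = (iota a * x + iota b) / (iota c * x + iota d)].
Proof.
move=> tx tu [A [C [C0 uE]]] [A' [C' [C'0 xE]]].
have lin_neq0 (a c : {poly k}) : c != 0 -> a%:P + c%:P * 'X != 0 :> {poly {poly k}}.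
  apply: contraNneq => /polyP/(_ 1); rewrite coefD coefC coefCM coefX coef0 /=.
  by rewrite add0r mulr1 => ->.
have ev_lin y z a c : eval_at iota y z (a%:P + c%:P * 'X) = ev z a + ev z c * y.
  by rewrite rmorphD rmorphM /= !eval_atC -eval_at_swap swapXY_X eval_atC evX.
have [||||||R [R0 szR szsR Rxu]] := @bidegree _ _ iota x u 2 2 (- A'%:P + C'%:P * 'X) (- A%:P + C%:P * 'X) tu.
- by rewrite -polyCN lin_neq0.
- by rewrite -polyCN size_lin.
- by rewrite -polyCN ev_lin xE rmorphN /= mulrCA mulfV ?ev_neq0 // mulr1 addNr.
- by rewrite -polyCN lin_neq0.
- by rewrite -polyCN size_lin.
- by rewrite -polyCN ev_lin uE rmorphN /= mulrCA mulfV ?ev_neq0 // mulr1 addNr.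
have szc i : (size (R`_i)%R <= 2)%N.
  by apply: leq_trans szsR; rewrite -sizeYE max_size_coefXY.
have R0' : ~ [/\ R`_0`_0 = 0, R`_0`_1 = 0, R`_1`_0 = 0 & R`_1`_1 = 0].
  case=> R00 R01 R10 R11; case/eqP: R0; apply/polyP=> i; apply/polyP=> j; rewrite !coef0.
  have [i2|i2] := ltnP i 2; last by rewrite (nth_default _ (leq_trans szR i2)) coef0.
  have [j2|j2] := ltnP j 2; last by rewrite (nth_default _ (leq_trans (szc i) j2)).
  by case: i i2 => [|[|]] //; case: j j2 => [|[|]].
move: Rxu; rewrite (eval_at_sum _ _ _ szR) !big_ord_recl big_ord0 /= /bump /= addr0 expr1 mulr1.
rewrite !(ev_sum _ (szc _)) !big_ord_recl !big_ord0 /= /bump /= !addr0 !expr1 !mulr1 => Rxu.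
have lin0 a b : iota a * x + iota b = 0 -> a = 0 /\ b = 0.
  move=> E; have /tx/polyP P0 : ev x (b%:P + a%:P * 'X) = 0.
    by rewrite rmorphD rmorphM /= !evC evX addrC.
  move: (P0 0) (P0 1); rewrite !coefD !coefCM !coefC !coefX ?coef0 /=.
  by rewrite mulr0 mulr1 addr0 add0r.
have cxd0 : iota R`_1`_1 * x + iota R`_0`_1 != 0.
  apply/eqP=> cd0; have [c0 d0] := lin0 _ _ cd0; apply: R0'.
  move: Rxu; rewrite c0 d0 rmorph0 !mul0r !addr0 addrC.
  by case/lin0.
have uE2 : u = (iota (- R`_1`_0) * x + iota (- R`_0`_0)) / (iota R`_1`_1 * x + iota R`_0`_1).
  apply/eqP; rewrite -subr_eq0 -(mulfK cxd0 u) -mulrBl mulf_eq0 invr_eq0 (negPf cxd0) orbF.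
  by rewrite !rmorphN /= -Rxu; apply/eqP; ring.
exists (- R`_1`_0), (- R`_0`_0), R`_1`_1, R`_0`_1; split=> //.
set a := - R`_1`_0 in uE2 *; set b := - R`_0`_0 in uE2 *.
set c := R`_1`_1 in uE2 cxd0 *; set d := R`_0`_1 in uE2 cxd0 *.
have unc e : u != iota e.
  apply/eqP=> ue; have /tu/eqP : ev u ('X - e%:P) = 0 by rewrite rmorphB /= evX evC ue subrr.
  by rewrite polyXsubC_eq0.
apply/eqP=> det0; have [c0|c0] := eqVneq c 0.
  have d0 : d != 0.
    by apply: contraNneq cxd0 => d0; rewrite c0 d0 rmorph0 mul0r addr0.
  move: det0; rewrite c0 mulr0 subr0 => /eqP; rewrite mulf_eq0 (negPf d0) orbF => /eqP a0.
  by case/eqP: (unc (b / d)); rewrite uE2 a0 c0 rmorph0 !mul0r !add0r fmorph_div.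
case/eqP: (unc (a / c)); rewrite uE2 fmorph_div; apply/eqP.
rewrite eqr_div ?fmorph_eq0 //; apply/eqP.
have -> : (iota a * x + iota b) * iota c = iota a * (iota c * x + iota d) - iota (a * d - b * c).
  by rewrite rmorphB !rmorphM /=; ring.
by rewrite det0 rmorph0 subr0.
Qed.
Hypothesis char0 : [pchar k] =i pred0.

Lemma natrK_neq0 n : n.+1%:R != 0 :> K.
Proof. by rewrite -(rmorph_nat iota) fmorph_eq0 (natr_neq0 char0). Qed.

Lemma model_transcendental x y F : is_model x y F -> transcendental x.
Proof.
by case=> _ free _ p px; case: (free p 0) => //; rewrite px rmorph0 mul0r addr0.
Qed.

Lemma model_irrational x y F : is_model x y F -> ~ rat x y.
Proof.
move=> M; have tx := model_transcendental M; case: M => _ free _ [A [C [C0 yE]]].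
case: (free A (- C)) => [|_ /eqP]; last by rewrite oppr_eq0 (negPf C0).
by rewrite rmorphN yE mulNr mulrCA mulfV ?ev_neq0 // mulr1 subrr.
Qed.

(** The cross term of the square of A + B y is irrational, so A or B vanishes. *)
Lemma model_sqrt x y F z : is_model x y F -> rat x (z ^+ 2) ->
  rat x z \/ exists B C, [/\ B != 0, C != 0 & z = ev x B / ev x C * y].
Proof.
move=> M rz2; have tx := model_transcendental M; have iry := model_irrational M.
case: M => y2 free /(_ z) [A [B [C [C0 zE]]]].
have Cx := ev_neq0 tx C0.
have [B0|B0] := eqVneq B 0.
  by left; exists A, C; rewrite zE B0 rmorph0 mul0r addr0.
have [A0|A0] := eqVneq A 0.
  by right; exists B, C; split=> //; rewrite zE A0 rmorph0 add0r mulrAC.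
case: iry; have AB0 : 2%:R * ev x A * ev x B != 0.
  by rewrite !mulf_neq0 ?ev_neq0 // natrK_neq0.
have -> : y = (z ^+ 2 * ev x (C ^+ 2) - ev x (A ^+ 2 + B ^+ 2 * F)) / ev x (2%:R * A * B).
  apply/esym/(canLR (mulfK _)).
    by rewrite !rmorphM /= rmorph_nat.
  rewrite zE !(rmorph_nat, rmorphD, rmorphM, rmorphXn) /= -y2; field; exact: Cx.
apply: ratM => //; last by apply: ratV => //; apply: rat_ev.
apply: ratD => //; first by apply: ratM => //; apply: rat_ev.
by apply: ratN => //; apply: rat_ev.
Qed.

(** Otherwise K would be k(x, sqrt D) as well, and every root of F, being a branch
point, would be a root of D. *)
Lemma no_small_branch x y F D z : is_model x y F -> separable_poly F ->
  (5 < size F)%N -> (size D <= 5)%N -> z ^+ 2 = ev x D -> rat x z.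
Proof.
move=> M sepF szF szD z2; have tx := model_transcendental M.
have [|//|[B [C [B0 C0 zE]]]] := model_sqrt (z := z) M.
  by rewrite z2; apply: rat_ev.
have Cx := ev_neq0 tx C0; case: M => y2 _ _.
have E : F * B ^+ 2 = D * C ^+ 2.
  apply: (ev_inj tx); rewrite !(rmorphM, rmorphXn) /= -y2 -z2 zE.
  by field; exact: Cx.
have FD := squarefree_dvdp sepF B0 E.
have D0 : D != 0.
  apply: contra_eq_neq E => ->; rewrite mul0r mulf_neq0 ?expf_neq0 //.
  exact: separable_poly_neq0.
by have := leq_trans szF (leq_trans (dvdp_leq D0 FD) szD).
Qed.

(** The norm equation (C u - A)^2 = B^2 F of u over k(x). *)
Lemma model_quadratic x y F u : is_model x y F ->
  exists P : {poly {poly k}}, [/\ P != 0, (size P <= 3)%N & eval_at iota u x P = 0].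
Proof.
move=> M; have tx := model_transcendental M; case: M => y2 _ /(_ u) [A [B [C [C0 uE]]]].
exists ((A ^+ 2 - B ^+ 2 * F)%:P + (- 2%:R * A * C)%:P * 'X + (C ^+ 2)%:P * 'X^2).
split; [|exact: size_quad|].
  apply/eqP=> /polyP/(_ 2); rewrite !coefD !coefCM coefC coefX coefXn coef0 /=.
  by rewrite mulr0 !add0r mulr1 => /eqP; rewrite expf_eq0 (negPf C0).
rewrite !(rmorphD, rmorphM, rmorphXn) /= !eval_atC -eval_at_swap swapXY_X eval_atC evX.
rewrite !(rmorph_nat, rmorphB, rmorphM, rmorphXn, rmorphN) /= -y2 uE.
by field; exact: ev_neq0.
Qed.

(** Uniqueness of the projection of degree 2. Multiplying the relation
a u^2 + b u + c = 0, of degree at most 2 in x, by 4 a completes the square: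
2 a u + b is a square root of b^2 - 4 a c, which has degree at most 4. *)
Lemma model_rat x y F u v G : is_model x y F -> separable_poly F ->
  (5 < size F)%N -> is_model u v G -> rat x u.
Proof.
move=> M sepF szF N; have tx := model_transcendental M; have tu := model_transcendental N.
have [P [P0 szP Pxu]] := model_quadratic x N.
have [Q [Q0 szQ Qux]] := model_quadratic u M.
have [R [R0 szR szsR Rxu]] := bidegree tu P0 szP Pxu Q0 szQ Qux.
set S := swapXY R in szsR; have szc i : (size (S`_i)%R <= 3)%N.
  by apply: leq_trans szR; rewrite -(swapXYK R) -sizeYE max_size_coefXY.
have S0 : ~ [/\ S`_0 = 0, S`_1 = 0 & S`_2 = 0].
  case=> e0 e1 e2; case/eqP: R0; rewrite -(swapXYK R) -/S.
  suff -> : S = 0 by rewrite raddf0.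
  apply/polyP=> i; rewrite coef0.
  have [i3|i3] := ltnP i 3; last by rewrite nth_default // (leq_trans szsR).
  by case: i i3 => [|[|[|]]].
move: Rxu; rewrite -eval_at_swap (eval_at_sum _ _ _ szsR) !big_ord_recl big_ord0 /= /bump /=.
rewrite addr0 mulr1 expr1 -[(1 + 1)%N]/2%N.
move: (S`_0) (S`_1) (S`_2) S0 (szc 0) (szc 1) (szc 2).
move=> c b a abc0 szc0 szb sza E.
have [a0|a0] := eqVneq a 0.
  have [b0|b0] := eqVneq b 0.
    case: abc0; split=> //; apply: tx; move: E.
    by rewrite a0 b0 rmorph0 !mul0r !addr0.
  suff -> : u = ev x (- c) / ev x b by exists (- c), b.
  apply/esym/(canLR (mulfK _)); first exact: ev_neq0.
  by move/eqP: E; rewrite a0 rmorph0 mul0r addr0 addr_eq0 => /eqP Ec; rewrite rmorphN /= Ec opprK mulrC.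
(* Completing the square. *)
have rz : rat x (ev x (2%:R * a) * u + ev x b).
  apply: (no_small_branch (D := b ^+ 2 - (4%:R)%:P * (a * c)) M) => //.
    rewrite (leq_trans (size_polyD _ _)) // geq_max size_polyN.
    rewrite (leq_trans (size_exp_leq _ _)) /=; last by rewrite muln2 ltnS; case: (size b) szb => [|[|[|[|]]]].
    rewrite mul_polyC (leq_trans (size_scale_leq _ _)) // (leq_trans (size_polyMleq _ _)) //.
    by case: (size a) (size c) sza szc0 => [|[|[|[|]]]] // [|[|[|[|]]]].
  rewrite -[RHS]addr0 -(mulr0 (4%:R * ev x a)) -E !(rmorphB, evC, rmorph_nat, rmorphM, rmorphXn) /=.
  by ring.
suff -> : u = (ev x (2%:R * a) * u + ev x b - ev x b) / ev x (2%:R * a).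
  by apply: ratM => //; [apply: ratD => //; rewrite -rmorphN; apply: rat_ev | apply: ratV => //; apply: rat_ev].
rewrite addrK mulrAC mulfV ?mul1r // ev_neq0 // mulf_neq0 //.
by rewrite -polyC_natr polyC_eq0 (natr_neq0 char0).
Qed.

(** If x needed v, then v, and with it all of K, would lie in k(x). *)
Lemma model_rat_conv x y F u v G : is_model x y F -> is_model u v G -> rat x u -> rat u x.
Proof.
move=> M N xu; have tx := model_transcendental M; have tu := model_transcendental N.
have irv := model_irrational M; case: N => v2 free gen; have [A [B [C [C0 xE]]]] := gen x.
have [B0|B0] := eqVneq B 0.
  by exists A, C; rewrite xE B0 rmorph0 mul0r addr0.
have Bu := ev_neq0 tu B0; have Cu := ev_neq0 tu C0.
have r p : rat x (ev u p) by apply: (rat_trans tx xu); apply: rat_ev.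
have rv : rat x v.
  have -> : v = (x * ev u C - ev u A) / ev u B by rewrite xE; field; rewrite Bu Cu.
  apply: ratM => //; last by apply: ratV.
  by apply: ratD => //; [apply: ratM => //; apply: rat_id | apply: ratN].
case: irv; have [A1 [B1 [C1 [C10 ->]]]] := gen y.
by apply: ratM => //; [apply: ratD => //; apply: ratM | apply: ratV].
Qed.

(** The substitution of a X + b Z and c X + d Z in the degree 8 homogenization of
G, dehomogenized by Z = 1. *)
Definition form_subst G (a b c d : k) : {poly k} :=
  \sum_(i < 9) G`_i *: ((a *: 'X + b%:P) ^+ i * (c *: 'X + d%:P) ^+ (8 - i)).

Lemma ev_form_subst x G a b c d : (size G <= 9)%N -> iota c * x + iota d != 0 ->
  ev x (form_subst G a b c d) =
  ev ((iota a * x + iota b) / (iota c * x + iota d)) G * (iota c * x + iota d) ^+ 8.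
Proof.
move=> szG cd0; rewrite (ev_sum _ szG) /form_subst rmorph_sum mulr_suml; apply: eq_bigr => i _ /=.
rewrite evZ rmorphM !rmorphXn !rmorphD /= !evZ !evX !evC expr_div_n -!mulrA; congr (_ * (_ * _)).
have i8 : (i <= 8)%N by rewrite -ltnS.
case: i i8 => i /= _ i8; by rewrite -[in RHS](subnKC i8) exprD mulKf ?expf_neq0.
Qed.

Lemma size_form_subst G a b c d : (size (form_subst G a b c d) <= 9)%N.
Proof.
have sz (e f : k) n : (size ((e *: 'X + f%:P) ^+ n : {poly k})%R <= n.+1)%N.
  have s2 : (size (e *: 'X + f%:P : {poly k})%R <= 2)%N.
    by have := size_lin f e; rewrite addrC mul_polyC.
  apply: leq_trans (size_exp_leq _ _) _; rewrite ltnS.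
  by case: (size _) s2 => [|[|[|]]] //= _; rewrite ?mul1n.
apply: leq_trans (size_sum _ _ _) _; apply/bigmax_leqP => i _.
apply: leq_trans (size_scale_leq _ _) _; apply: leq_trans (size_polyMleq _ _) _.
have i8 : (i <= 8)%N by rewrite -ltnS.
have := leq_add (sz a b i) (sz c d (8 - i)%N); rewrite addSn addnS subnKC //.
by case: (_ + _)%N.
Qed.

(** With u = (a x + b) / (c x + d), the form H of G satisfies H C^2 = F B^2, so F
divides H. The quotient S satisfies S C^2 = B^2, so it has even degree, and its
degree is at most 1 because F has degree at least 7: it is constant. *)
Lemma model_transport x y F u v G : is_model x y F -> separable_poly F ->
    (7 < size F)%N -> is_model u v G -> (size G <= 9)%N ->
  exists a b c d lam, [/\ a * d - b * c != 0, lam != 0, iota c * x + iota d != 0,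
     u = (iota a * x + iota b) / (iota c * x + iota d)
   & form_subst G a b c d = lam *: F].
Proof.
move=> M sepF szF N szG; have tx := model_transcendental M; have tu := model_transcendental N.
have szF5 : (5 < size F)%N by apply: leq_trans szF.
have ru := model_rat M sepF szF5 N; have rx := model_rat_conv M N ru.
have [a [b [c [d [det0 cd0 uE]]]]] := moebius tx tu ru rx.
exists a, b, c, d.
have irv := model_irrational N.
have [v2 _ _] := N.
have [|rv|[B [C [B0 C0 vE]]]] := model_sqrt (z := v) M.
- by rewrite v2; apply: (rat_trans tx ru); apply: rat_ev.
- by case: irv; apply: (rat_trans tu rx).
set H := form_subst G a b c d.
have [y2 _ _] := M; have Cx := ev_neq0 tx C0.
(* v^2 = G(u) after clearing the denominators (c x + d)^8 and C^2. *)
have E : F * (B * (c *: 'X + d%:P) ^+ 4) ^+ 2 = H * C ^+ 2.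
  apply: (ev_inj tx); rewrite !rmorphM /= ev_form_subst // -uE -v2 vE.
  rewrite !(rmorphM, rmorphXn, rmorphD) /= !evZ !evX !evC -y2.
  by field; exact: Cx.
have cd0' : c *: 'X + d%:P != 0.
  by apply: contraNneq cd0 => /(congr1 (ev x)); rewrite rmorphD /= evZ evX evC rmorph0 => ->.
have B'0 : B * (c *: 'X + d%:P) ^+ 4 != 0 by rewrite mulf_neq0 ?expf_neq0.
have /dvdpP[S HE] := squarefree_dvdp sepF B'0 E.
have F0 := separable_poly_neq0 sepF.
have S0 : S != 0.
  by apply: contra_eq_neq E => S0; rewrite HE S0 !mul0r mulf_neq0 ?expf_neq0.
have {}E : (B * (c *: 'X + d%:P) ^+ 4) ^+ 2 = S * C ^+ 2.
  by apply: (mulfI F0); rewrite E HE; ring.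
have szS : (size S <= 2)%N.
  have arith m n : (7 < n -> (m + n).-1 <= 9 -> m <= 2)%N by lia.
  have := size_form_subst G a b c d; rewrite -/H HE size_mul //; exact: arith.
have : size S != 2.
  apply/eqP=> sz2; move: (B * _) B'0 E => Q Q0 /(congr1 (fun p : {poly k} => size p)).
  have C20 : C ^+ 2 != 0 by rewrite expf_neq0.
  rewrite expr2 size_mul // size_mul // expr2 size_mul // sz2.
  by rewrite (polySpred Q0) (polySpred C0); clear; lia.
move=> sz2; have : size S == 1.
  by case: (size S) szS sz2 (size_poly_eq0 S) => [|[|[|]]] //= _ _; rewrite (negPf S0).
case/size_poly1P=> lam lam0 SE; exists lam; split=> //.
by rewrite -/H HE SE mul_polyC.
Qed.
End Uniqueness.

(** * Changing the model *)

Section Models.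
Variables (k : closedFieldType) (K : fieldType) (iota : {rmorphism k -> K}).
Local Notation ev := (evalk iota).
Local Notation is_model := (is_model iota).
Local Notation transcendental := (transcendental iota).
Local Notation rat := (rational_in iota).
Implicit Types (A B C D F G H P Q : {poly k}) (x y z u v w : K).
Hypothesis char0 : [pchar k] =i pred0.

(** Degree 7 is allowed: the form of degree 8 then has a simple root at
infinity. *)
Definition squarefree_octavic F := separable_poly F /\ (7 < size F <= 9)%N.

(** The field of constants is algebraically closed. *)
Lemma transcendentalP w : (forall c, w != iota c) -> transcendental w.
Proof.
move=> wc p; have [r ->] := closed_field_poly_normal p.
rewrite evZ => /eqP; rewrite mulf_eq0 fmorph_eq0 => /orP[/eqP->|]; first by rewrite scale0r.
move=> E; exfalso; move: E; elim: r => [|z r IH].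
  by rewrite big_nil rmorph1 oner_eq0.
rewrite big_cons rmorphM mulf_eq0 rmorphB /= evX evC subr_eq0 (negPf (wc z)).
exact: IH.
Qed.

Lemma transcendental_lin x c d : transcendental x -> (c != 0) || (d != 0) ->
  iota c * x + iota d != 0.
Proof.
move=> tx; apply: contraTneq => E; have /tx/polyP P0 : ev x (d%:P + c%:P * 'X) = 0.
  by rewrite rmorphD rmorphM /= !evC evX addrC.
move: (P0 0) (P0 1); rewrite !coefD !coefCM !coefC !coefX ?coef0 /=.
by rewrite mulr0 mulr1 addr0 add0r => -> ->; rewrite eqxx.
Qed.

(** Square factors of F are absorbed in y. *)
Lemma model_drop_square w v P Q : P != 0 -> is_model w v (P ^+ 2 * Q) ->
  is_model w (v / ev w P) Q.
Proof.
move=> P0 M; have tw := model_transcendental M; have Pw := ev_neq0 tw P0.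
case: M => v2 free gen; split.
- by rewrite expr_div_n v2 rmorphM rmorphXn /= mulrAC mulfV ?mul1r // expf_neq0.
- move=> A B E; have [|/eqP] := free (A * P) B.
    by rewrite rmorphM /= -[RHS](mul0r (ev w P)) -E mulrDl -mulrA divfK.
  by rewrite mulf_eq0 (negPf P0) orbF => /eqP.
- move=> z; have [A [B [C [C0 ->]]]] := gen z; exists A, (B * P), C; split=> //.
  by rewrite rmorphM /= -mulrA [ev w P * _]mulrC divfK.
Qed.

(** A nonzero v in k(x) y is as irrational over k(w) = k(x) as y. *)
Lemma model_change x y F w v G : is_model x y F -> rat x w -> rat w x ->
    transcendental w -> v ^+ 2 = ev w G -> rat x (v / y) -> v != 0 ->
  is_model w v G.
Proof.
move=> M xw wx tw v2 vy v0; have tx := model_transcendental M.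
have iry := model_irrational M.
have y0 : y != 0.
  by apply/eqP=> y0; case: iry; rewrite y0 -(rmorph0 iota); apply: rat_iota.
have yv : rat w (y / v).
  by apply: (rat_trans tw wx); rewrite -invf_div; apply: ratV.
have irv : ~ rat w v.
  move=> rv; apply: iry; apply: (rat_trans tx xw).
  by rewrite -[y](divfK v0); apply: ratM.
split=> // [A B E|z].
  have [B0|B0] := eqVneq B 0.
    by split=> //; apply: tw; move: E; rewrite B0 rmorph0 mul0r addr0.
  case: irv; have -> : v = - ev w A / ev w B.
    have/eqP := E; rewrite addrC addr_eq0 => /eqP <-.
    by rewrite mulrAC mulfV ?mul1r // ev_neq0.
  by apply: ratM => //; [apply: ratN => //; apply: rat_ev | apply: ratV => //; apply: rat_ev].
case: M => _ _ /(_ z) [A [B [C [C0 ->]]]].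
have r p : rat w (ev x p) by apply: (rat_trans tw wx); apply: rat_ev.
have [A1 [C1 [C10 E1]]] : rat w (ev x A / ev x C) by apply: ratM => //; apply: ratV.
have [B2 [C2 [C20 E2]]] : rat w (ev x B / ev x C * (y / v)).
  by do 2?apply: ratM => //; apply: ratV.
exists (A1 * C2), (B2 * C1), (C1 * C2); rewrite mulf_neq0 //; split=> //.
rewrite mulrDl [ev x B * y / _]mulrAC E1 -[y](divfK v0) mulrA E2 !rmorphM /=.
by field; rewrite !ev_neq0.
Qed.

(** The new second generator is y (a - c w)^4, where w is the new coordinate: its
square clears the denominator (a - c w)^8 of F(x). *)
Lemma model_moebius x y F a b c d : is_model x y F -> (size F <= 9)%N -> a * d - b * c != 0 ->
  exists v G, is_model ((iota a * x + iota b) / (iota c * x + iota d)) v G /\ (size G <= 9)%N.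
Proof.
move=> M szF det0; have tx := model_transcendental M.
have cd0 : iota c * x + iota d != 0.
  apply: transcendental_lin => //; rewrite -negb_and; apply: contra det0.
  by case/andP=> /eqP-> /eqP->; rewrite !mulr0 subrr.
set w := _ / _.
have wE : w * (iota c * x + iota d) = iota a * x + iota b by rewrite divfK.
have detK : iota a * iota d - iota b * iota c != 0.
  by rewrite -!rmorphM -rmorphB fmorph_eq0.
have aw : iota (- c) * w + iota a = (iota a * iota d - iota b * iota c) / (iota c * x + iota d).
  by rewrite /w rmorphN /=; field; exact: cd0.
have aw0 : iota (- c) * w + iota a != 0 by rewrite aw mulf_neq0 ?invr_eq0.
have xE : x = (iota d * w + iota (- b)) / (iota (- c) * w + iota a).
  rewrite aw /w rmorphN /=; field; rewrite detK cd0 //.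
have rlin (e f : k) : rat x (iota e * x + iota f).
  by apply: ratD => //; [apply: ratM => //; [apply: rat_iota|apply: rat_id] | apply: rat_iota].
have xw : rat x w by apply: ratM => //; apply: ratV.
have tw : transcendental w.
  apply: transcendentalP => e; apply/eqP => we.
  have /eqP[] : iota (a - e * c) * x + iota (b - e * d) != 0.
    apply: transcendental_lin => //; rewrite -negb_and; apply: contra det0.
    rewrite !subr_eq0 => /andP[/eqP-> /eqP->].
    by apply/eqP; ring.
  have := wE; rewrite we => wE'.
  rewrite !rmorphB !rmorphM /= -(subrr (iota e * (iota c * x + iota d))) [X in _ = X - _]wE'.
  by ring.
have wx : rat w x.
  have wlin (e f : k) : rat w (iota e * w + iota f).
    by apply: ratD => //; [apply: ratM => //; [apply: rat_iota|apply: rat_id] | apply: rat_iota].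
  by rewrite xE; apply: ratM => //; apply: ratV.
have y0 : y != 0.
  apply/eqP=> y0; case: (model_irrational M); rewrite y0 -(rmorph0 iota); exact: rat_iota.
exists (y * (iota (- c) * w + iota a) ^+ 4), (form_subst F d (- b) (- c) a).
split; last exact: size_form_subst.
apply: (model_change M) => //; last by rewrite mulf_neq0 ?expf_neq0.
- by rewrite ev_form_subst // -xE; case: M => <- _ _; ring.
- rewrite mulrAC mulfV // mul1r.
  have r1 : rat x (iota (- c) * w + iota a).
    by apply: ratD => //; [apply: ratM => // | ]; apply: rat_iota.
  by rewrite !exprS expr0 mulr1; do 3?[apply: ratM => //].
Qed.

(** In degree at most 6 the form of degree 8 of Q has a double root at infinity, so
by transport that of F has a double root too. *)
Lemma model_size x y F w v Q : is_model x y F -> squarefree_octavic F ->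
  is_model w v Q -> (size Q <= 9)%N -> (7 < size Q)%N.
Proof.
move=> M [sepF /andP[szF7 szF9]] N szQ; rewrite ltnNge; apply/negP => szQ7.
have [a [b [c [d [lam [det0 lam0 cd0 _ E]]]]]] := model_transport char0 M sepF szF7 N szQ.
have Qi (i : 'I_9) : (6 < i)%N -> Q`_i = 0 by move=> i6; rewrite nth_default // (leq_trans szQ7).
have [c0|c0] := eqVneq c 0.
  suff : (size (form_subst Q a b c d) <= 7)%N.
    by rewrite E size_scale // leqNgt szF7.
  apply: leq_trans (size_sum _ _ _) _; apply/bigmax_leqP => i _.
  have [i6|i6] := ltnP 6 i; first by rewrite Qi // scale0r size_poly0.
  rewrite c0 scale0r add0r -polyC_exp mulrC mul_polyC.
  do 2!apply: leq_trans (size_scale_leq _ _) _.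
  have s2 : (size (a *: 'X + b%:P : {poly k})%R <= 2)%N.
    by have := size_lin b a; rewrite addrC mul_polyC.
  apply: leq_trans (size_exp_leq _ _) _; move: s2 i6; case: (size _) => [|[|[|]]] //= _; lia.
have : (c *: 'X + d%:P) ^+ 2 %| F.
  rewrite -(dvdpZr _ _ lam0) -E /form_subst.
  elim/big_ind: _ => [|p q|i _]; [exact: dvdp0 | exact: dvdp_add |].
  have [i6|i6] := ltnP 6 i; first by rewrite Qi // scale0r dvdp0.
  have -> : (8 - i = 2 + (6 - i))%N by lia.
  by rewrite exprD mulrCA scalerAr dvdp_mulr.
apply/negP; apply/negbT/separable_nosquare => //.
by rewrite -mul_polyC size_MXaddC polyC_eq0 (negPf c0) size_polyC c0.
Qed.
End Models.

Section Models2.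
Variables (k : closedFieldType) (K : fieldType) (iota : {rmorphism k -> K}).
Local Notation ev := (evalk iota).
Local Notation is_model := (is_model iota).
Local Notation transcendental := (transcendental iota).
Implicit Types (A B C D F G H P Q : {poly k}) (x y z u v w : K).
Hypothesis char0 : [pchar k] =i pred0.

Lemma separableN_root F : F != 0 -> ~~ separable_poly F ->
  exists r Q, F = ('X - r%:P) ^+ 2 * Q.
Proof.
move=> F0; rewrite unlock /coprimep => /closed_rootP[r]; rewrite root_gcd => /andP[].
case/factor_theorem=> Q FE; rewrite FE derivM derivXsubC mulr1 => rd.
have /factor_theorem[Q' QE] : root Q r.
  by move: rd; rewrite /root !hornerE subrr mulr0 add0r.
by exists r, Q'; rewrite QE; ring.
Qed.

(** The branch points do not depend on the model: a double root of G could be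
absorbed in v, leaving an equation of degree at most 6. *)
Lemma model_squarefree x y F w v G : is_model x y F -> squarefree_octavic F ->
  is_model w v G -> (size G <= 9)%N -> squarefree_octavic G.
Proof.
move=> M sF N szG; have szG7 := model_size char0 M sF N szG.
split; last by rewrite szG7.
apply: contraT => /(separableN_root _)[|r [Q GE]].
  by rewrite -size_poly_gt0 (leq_trans _ szG7).
have X0 : 'X - r%:P != 0 :> {poly k} by rewrite polyXsubC_eq0.
rewrite GE in N; have N' := model_drop_square X0 N.
have Q0 : Q != 0.
  by apply: contraTneq szG7 => Q0; rewrite GE Q0 mulr0 size_poly0.
have arith m n : n = m.+2 -> (n <= 9)%N -> (m <= 9)%N /\ ~~ (7 < m)%N by lia.
have szGE : size G = (size Q).+2.
  by rewrite GE size_mul ?expf_neq0 // expr2 size_mul // !size_XsubC.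
have [szQ /negP[]] := arith _ _ szGE szG.
exact: (model_size char0 M sF N' szQ).
Qed.

(** The unique expression of z in one model, up to a common factor, is evaluated in
the other one. *)
Lemma model_auto_ex x y x' y' F : is_model x y F -> is_model x' y' F ->
  exists s : K -> K, [/\ is_automorphism iota s, s x = x' & s y = y'].
Proof.
pose T := ({poly k} * {poly k} * {poly k})%type.
pose val a b (t : T) := (ev a t.1.1 + ev a t.1.2 * b) / ev a t.2.
have rep a b : is_model a b F -> forall z, {t : T | (t.2 != 0) && (z == val a b t)}.
  move=> M z; apply: sigW; case: M => _ _ /(_ z) [A [B [C [C0 zE]]]].
  by exists (A, B, C); rewrite /= C0 /val -zE /=.
pose tr a b c d (M : is_model a b F) z := val c d (sval (rep a b M z)).
have trE a b c d (M : is_model a b F) (N : is_model c d F) (t : T) :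
    t.2 != 0 -> tr a b c d M (val a b t) = val c d t.
  rewrite /tr; case: (rep _ _ _ _) => t' /= /andP[t'0 /eqP E] t0.
  have ta := model_transcendental M; have tc := model_transcendental N.
  case: M => _ free _; case: (free (t.1.1 * t'.2 - t'.1.1 * t.2) (t.1.2 * t'.2 - t'.1.2 * t.2)).
    rewrite !rmorphB !rmorphM /=; move/eqP: E; rewrite /val eqr_div ?ev_neq0 // => /eqP.
    move/eqP; rewrite -subr_eq0 => /eqP E; rewrite -[RHS]E; ring.
  move=> /eqP + /eqP; rewrite !subr_eq0 => /eqP E1 /eqP E2.
  apply/eqP; rewrite /val eqr_div ?ev_neq0 //; apply/eqP.
  by rewrite !mulrDl ![_ * d * _]mulrAC -!rmorphM /= E1 E2.
move=> M N; exists (tr x y x' y' M).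
have tx := model_transcendental M; have tx' := model_transcendental N.
have repE z : exists2 t : T, t.2 != 0 & z = val x y t.
  by case: (rep x y M z) => t /andP[t0 /eqP ->]; exists t.
have trM := trE _ _ _ _ M N.
have [y2 _ _] := M; have [y'2 _ _] := N.
split.
- split.
  + exists (tr x' y' x y N) => z.
      by have [t t0 ->] := repE z; rewrite trM // trE.
    by case: (rep x' y' N z) => t /andP[t0 /eqP ->]; rewrite (trE _ _ _ _ N M) // trM.
  + move=> u v; have [t t0 ->] := repE u; have [r r0 ->] := repE v.
    rewrite !trM //.
    have E a b : transcendental a -> val a b t + val a b r =
       val a b (t.1.1 * r.2 + r.1.1 * t.2, t.1.2 * r.2 + r.1.2 * t.2, t.2 * r.2).
      by move=> ta; rewrite /val !(rmorphD, rmorphM) /=; field; rewrite !ev_neq0.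
    by rewrite !E // trM //= mulf_neq0.
  + move=> u v; have [t t0 ->] := repE u; have [r r0 ->] := repE v.
    rewrite !trM //.
    have E a b : transcendental a -> b ^+ 2 = ev a F -> val a b t * val a b r =
       val a b (t.1.1 * r.1.1 + t.1.2 * r.1.2 * F, t.1.1 * r.1.2 + r.1.1 * t.1.2, t.2 * r.2).
      by move=> ta b2; rewrite /val !(rmorphD, rmorphM) /= -b2; field; rewrite !ev_neq0.
    by rewrite !E // trM //= mulf_neq0.
  + move=> c; have E a b : iota c = val a b (c%:P, 0, 1).
      by rewrite /val /= evC rmorph0 mul0r addr0 rmorph1 divr1.
    by rewrite {1}(E x y) trM ?oner_neq0 // -E.
- have E a b : a = val a b ('X, 0, 1) by rewrite /val /= evX rmorph0 mul0r addr0 rmorph1 divr1.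
  by rewrite {2}(E x y) trM ?oner_neq0 // -E.
- have E a b : b = val a b (0, 1, 1) by rewrite /val /= rmorph1 mul1r rmorph0 add0r divr1.
  by rewrite {2}(E x y) trM ?oner_neq0 // -E.
Qed.

Lemma auto_rmorph (s : K -> K) : is_automorphism iota s ->
  exists2 f : {rmorphism K -> K}, f =1 s & forall c, f (iota c) = iota c.
Proof.
case=> _ sD sM sc.
have s0 : s 0 = 0 by rewrite -(rmorph0 iota) sc.
have sN u : s (- u) = - s u.
  by apply/eqP; rewrite -addr_eq0 -sD addNr s0.
have sB : zmod_morphism s by move=> u v; rewrite sD sN.
have s1 : monoid_morphism s by split=> //; rewrite -(rmorph1 iota) sc.
pose f : {rmorphism K -> K} := HB.pack s
  (GRing.isZmodMorphism.Build _ _ s sB) (GRing.isMonoidMorphism.Build _ _ s s1).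
by exists f.
Qed.

Section Auto.
Variable f : {rmorphism K -> K}.
Hypothesis fc : forall c, f (iota c) = iota c.

Lemma auto_ev x p : f (ev x p) = ev (f x) p.
Proof.
rewrite /evalk -horner_map -map_poly_comp; congr _.[_].
by apply: eq_map_poly => c /=.
Qed.

Lemma auto_model x y F : bijective f -> is_model x y F -> is_model (f x) (f y) F.
Proof.
move=> [g fK gK] [y2 free gen]; split.
- by rewrite -rmorphXn /= y2 auto_ev.
- move=> A B E; apply: free; apply: (fmorph_inj f).
  by rewrite rmorphD rmorphM /= !auto_ev E rmorph0.
- move=> z; have [A [B [C [C0 zE]]]] := gen (g z); exists A, B, C; split=> //.
  by rewrite -(gK z) zE fmorph_div rmorphD rmorphM /= !auto_ev.
Qed.
End Auto.

Lemma auto_ext (f g : {rmorphism K -> K}) x y F :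
    (forall c, f (iota c) = iota c) -> (forall c, g (iota c) = iota c) ->
    is_model x y F -> f x = g x -> f y = g y -> f =1 g.
Proof.
move=> fc gc [_ _ gen] Ex Ey z; have [A [B [C [_ ->]]]] := gen z.
by rewrite !fmorph_div !rmorphD !rmorphM /= !(auto_ev fc) !(auto_ev gc) Ex Ey.
Qed.

End Models2.

(** * A coordinate adapted to the dihedral action *)

Section Normal.
Variables (k : closedFieldType) (K : fieldType) (iota : {rmorphism k -> K}).
Local Notation ev := (evalk iota).
Local Notation is_model := (is_model iota).
Local Notation transcendental := (transcendental iota).
Implicit Types (A B C D F G H P Q : {poly k}) (x y z u v w : K).
Hypothesis char0 : [pchar k] =i pred0.

Definition octavic_model x y F := is_model x y F /\ squarefree_octavic F.

Lemma octavic_model_moebius x y F a b c d : octavic_model x y F -> a * d - b * c != 0 ->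
  exists v G, octavic_model ((iota a * x + iota b) / (iota c * x + iota d)) v G.
Proof.
move=> [M sF] det0; have szF : (size F <= 9)%N by case: sF => _ /andP[].
have [v [G [N szG]]] := model_moebius M szF det0.
by exists v, G; split=> //; apply: (model_squarefree char0 M sF N szG).
Qed.

Lemma octavic_model_affine x y F a b : octavic_model x y F -> a != 0 ->
  exists v G, octavic_model (iota a * x + iota b) v G.
Proof.
move=> M a0; have [] := @octavic_model_moebius x y F a b 0 1 M.
  by rewrite mulr1 mulr0 subr0.
by rewrite rmorph0 mul0r rmorph1 add0r divr1 => v [G N]; exists v, G.
Qed.

Lemma quad_eq0 x a b c : transcendental x ->
  iota a * x ^+ 2 + iota b * x + iota c = 0 -> [/\ a = 0, b = 0 & c = 0].
Proof.
move=> tx E; have /tx/polyP P0 : ev x (c%:P + b%:P * 'X + a%:P * 'X^2) = 0.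
  by rewrite !(rmorphD, rmorphM, rmorphXn) /= !evC evX -E; ring.
move: (P0 0) (P0 1) (P0 2); rewrite !coefD !coefCM !coefC !coefX !coefXn ?coef0 /=.
by rewrite !(mulr0, mulr1, addr0, add0r).
Qed.

Lemma auto_moebius (f : {rmorphism K -> K}) x y F : (forall c, f (iota c) = iota c) ->
    bijective f -> octavic_model x y F ->
  exists a b c d lam, [/\ a * d - b * c != 0, lam != 0, iota c * x + iota d != 0,
     f x = (iota a * x + iota b) / (iota c * x + iota d)
   & form_subst F a b c d = lam *: F].
Proof.
move=> fc fb [M [sF /andP[szF szF']]].
exact: (model_transport char0 M sF szF (auto_model fc fb M) szF').
Qed.

Section DihedralAction.
Variables R T : {rmorphism K -> K}.
Hypotheses (Rc : forall c, R (iota c) = iota c) (Tc : forall c, T (iota c) = iota c).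
Hypotheses (Rbij : bijective R) (Tbij : bijective T).
Hypotheses (R3 : forall z, R (R (R z)) = z) (R1 : ~ R =1 id).
Hypothesis TR : forall z, T (R z) = R (R (T z)).

(** An automorphism which fixes x maps y to y or - y, so its order divides 2. *)
Lemma order3_coordinate x y F : octavic_model x y F -> R x <> x.
Proof.
move=> [M _] Rx; have [y2 _ _] := M.
have : (R y - y) * (R y + y) = 0.
  have : R y ^+ 2 = y ^+ 2 by rewrite -rmorphXn /= y2 (auto_ev Rc) Rx.
  by move/eqP; rewrite -subr_eq0 subr_sqr => /eqP.
have y0 : y != 0.
  apply/eqP=> y0; case: (model_irrational M); rewrite y0 -(rmorph0 iota); exact: rat_iota.
move/eqP; rewrite mulf_eq0 subr_eq0 addr_eq0 => /orP[]/eqP Ry.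
  by apply: R1; apply: (auto_ext (g := idfun) Rc) M _ _.
have := R3 y; rewrite Ry rmorphN /= Ry opprK Ry => /eqP.
rewrite eq_sym -addr_eq0 -mulr2n -mulr_natl mulf_eq0 (negPf y0) orbF.
by rewrite (negPf (natrK_neq0 iota char0 1)).
Qed.

(** A fixed point of the Moebius transformation R is moved to infinity. *)
Lemma exists_affine_coordinate x y F : octavic_model x y F ->
  exists w v G a b, octavic_model w v G /\ R w = iota a * w + iota b.
Proof.
move=> M; have tx := model_transcendental M.1.
have [a [b [c [d [lam [det0 _ cd0 Rx _]]]]]] := auto_moebius Rc Rbij M.
have [c0|c0] := eqVneq c 0.
  exists x, y, F, (a / d), (b / d); split=> //.
  have d0 : d != 0 by apply: contraNneq cd0 => ->; rewrite c0 rmorph0 mul0r addr0.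
  by rewrite Rx c0 rmorph0 mul0r add0r !fmorph_div mulrDl mulrAC.
have [r] : exists r, root (c *: 'X^2 + (d - a) *: 'X - b%:P) r.
  apply/closed_rootP; rewrite -addrA size_polyDl.
    by rewrite size_scale ?size_polyXn.
  rewrite size_scale ?size_polyXn // ltnS (leq_trans (size_polyD _ _)) // geq_max size_polyN.
  rewrite (leq_trans (size_scale_leq _ _)) ?size_polyX //.
  by rewrite (leq_trans (size_polyC_leq1 _)).
move/rootP; rewrite !(hornerD, hornerN, hornerZ, hornerXn, hornerX, hornerC).
move/eqP; rewrite subr_eq0 => /eqP rE.
have E : b - d * r = r * (c * r - a) by rewrite -rE; ring.
have acz : a - c * r != 0.
  apply: contraNneq det0 => acz; have aE : a = c * r by apply/eqP; rewrite -subr_eq0 acz.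
  have -> : b = d * r.
    by apply/eqP; rewrite -subr_eq0 E aE subrr mulr0.
  by rewrite aE; apply/eqP; ring.
have det1 : 0 * - r - 1 * 1 != 0 :> k by rewrite mul0r sub0r mulr1 oppr_eq0 oner_neq0.
have [v [G N]] := octavic_model_moebius M det1.
exists ((iota 0 * x + iota 1) / (iota 1 * x + iota (- r))), v, G.
exists ((c * r + d) / (a - c * r)), (c / (a - c * r)); split=> //.
have xr0 : x - iota r != 0.
  by have := @transcendental_lin _ _ iota x 1 (- r) tx; rewrite oner_neq0 rmorph1 mul1r rmorphN; apply.
have acz' : iota a - iota c * iota r != 0 by rewrite -rmorphM -rmorphB fmorph_eq0.
rewrite !(fmorph_div, rmorphD, rmorphM, Rc, rmorph1, rmorph0, rmorphN, mul0r, mul1r, add0r) /= ?Rc. rewrite fmorphV rmorphB /= Rc Rx.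
have E1 : (iota a * x + iota b) / (iota c * x + iota d) - iota r
   = (iota a - iota c * iota r) * (x - iota r) / (iota c * x + iota d).
  have -> : iota b = iota (r * (c * r - a) + d * r) by rewrite -E subrK.
  by rewrite !(rmorphB, rmorphD, rmorphM) /=; field; exact: cd0.
by rewrite E1; field; rewrite cd0 acz' xr0.
Qed.

(** In an affine coordinate R is w -> a w + b with a^3 = 1. In characteristic 0 a
translation is not of order 3, so a is not 1, and the finite fixed point
b / (1 - a) is moved to 0. *)
Lemma exists_diagonal_coordinate x y F : octavic_model x y F ->
  exists w v G om, [/\ octavic_model w v G, R w = iota om * w, om ^+ 3 = 1 & om != 1].
Proof.
move=> /exists_affine_coordinate[w [v [G [a [b [M Rw]]]]]].
have tw := model_transcendental M.1.
have [_ /eqP E1 /eqP E0] : [/\ (0 : k) = 0, a ^+ 3 - 1 = 0 & b * (a ^+ 2 + a + 1) = 0].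
  apply: (quad_eq0 tw); rewrite -[RHS](subrr w) -[X in _ = X - _](R3 w).
  do 3!rewrite ?(Rw, rmorphD, rmorphM, Rc) /=.
  by rewrite !(rmorphD, rmorphB, rmorphM, rmorphXn, rmorph0, rmorph1) /=; ring.
have a3 : a ^+ 3 = 1 by apply/eqP; rewrite -subr_eq0.
have a1 : a != 1.
  apply/eqP=> a1; apply: (order3_coordinate M); rewrite Rw a1 rmorph1 mul1r.
  have : b * 3%:R == 0 by apply/eqP; rewrite -(eqP E0) a1; ring.
  by rewrite mulf_eq0 (negPf (natr_neq0 char0 2)) orbF => /eqP->; rewrite rmorph0 addr0.
have [v' [G' N]] := octavic_model_affine (b / (a - 1)) M (oner_neq0 k).
exists (iota 1 * w + iota (b / (a - 1))), v', G', a; split=> //.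
have a1' : iota a - 1 != 0 by rewrite -(rmorph1 iota) -rmorphB fmorph_eq0 subr_eq0.
rewrite !(rmorphD, rmorphM, Rc) /= rmorph1 Rw !mul1r fmorphV rmorphB rmorph1 /=.
by field.
Qed.

(** T inverts R, so it exchanges the fixed points 0 and infinity of R: it is
w -> e / w, and w is divided by a square root of e. *)
Lemma normal_coordinate x y F : octavic_model x y F ->
  exists w v G om,
    [/\ octavic_model w v G, R w = iota om * w, om ^+ 3 = 1, om != 1 & T w = w^-1].
Proof.
move=> /exists_diagonal_coordinate[w [v [G [om [M Rw om3 om1]]]]].
have tw := model_transcendental M.1.
have om0 : om != 0 by apply: contra_eq_neq om3 => ->; rewrite expr0n eq_sym oner_neq0.
have [a [b [c [d [lam [det0 _ cd0 Tw _]]]]]] := auto_moebius Tc Tbij M.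
have := TR w; rewrite Rw rmorphM Tc /= Tw !(fmorphV, rmorphD, rmorphM, Rc, Rw) /=.
have cd1 : iota c * (iota om * (iota om * w)) + iota d != 0.
  have : iota c * (iota om * (iota om * w)) + iota d = iota (c * om ^+ 2) * w + iota d.
    by rewrite rmorphM rmorphXn /=; ring.
  move=> ->; apply: transcendental_lin => //; rewrite mulf_eq0 expf_eq0 (negPf om0) /= orbF -negb_and.
  by apply: contra det0 => /andP[/eqP-> /eqP->]; rewrite !mulr0 subrr.
rewrite [iota om * (_ / _)]mulrA => /eqP; rewrite eqr_div // -subr_eq0 => /eqP E.
have om3' : iota om ^+ 3 = 1 by rewrite -rmorphXn om3 rmorph1.
have [/eqP e2 /eqP e1 /eqP e0] : [/\ a * c * (1 - om ^+ 2) = 0, a * d * (om - om ^+ 2) = 0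
       & b * d * (om - 1) = 0].
  apply: (quad_eq0 tw); move: E; set e := (X in X = 0) => E.
  transitivity (e - (iota a * iota c * w ^+ 2 + iota b * iota c * w) * (iota om ^+ 3 - 1)).
    by rewrite /e; ring.
  by rewrite E om3' subrr mulr0 subr0.
have om1' : om - 1 != 0 by rewrite subr_eq0.
have om2 : om ^+ 2 != 1.
  by apply: contra om1 => /eqP om2; rewrite -om3 exprS om2 mulr1.
move: e2 e1 e0; rewrite !mulf_eq0 (negPf om1') !orbF.
have -> : om - om ^+ 2 = om * (1 - om) by ring.
rewrite mulf_eq0 (negPf om0) !subr_eq0 ![1 == _]eq_sym (negPf om1) (negPf om2) !orbF.
move=> e2 e1 e0; have ad0 : a * d = 0 by apply/eqP; rewrite mulf_eq0.
move: det0; rewrite ad0 sub0r oppr_eq0 mulf_eq0 negb_or => /andP[b0 c0].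
rewrite (negPf c0) orbF in e2; rewrite (negPf b0) /= in e0.
have [mu muE] : exists mu, mu ^+ 2 = b / c.
  have [|mu] := @closed_rootP _ ('X^2 - (b / c)%:P) _; first by rewrite size_XnsubC.
  by rewrite /root !hornerE subr_eq0 => /eqP <-; exists mu.
have mu0 : mu != 0 by apply: contra_eq_neq muE => ->; rewrite expr0n eq_sym mulf_neq0 ?invr_eq0.
have mu1 : mu^-1 != 0 by rewrite invr_eq0.
have [v' [G' N]] := octavic_model_affine 0 M mu1.
move: N; rewrite rmorph0 addr0 => N; exists (iota mu^-1 * w), v', G', om; split=> //.
  by rewrite rmorphM Rc Rw mulrCA.
have bE : iota b = iota mu ^+ 2 * iota c by rewrite -rmorphXn muE fmorph_div divfK ?fmorph_eq0.
have w0 : w != 0.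
  by have := @transcendental_lin _ _ iota w 1 0 tw; rewrite oner_neq0 rmorph1 mul1r rmorph0 addr0; apply.
rewrite rmorphM Tc Tw (eqP e2) (eqP e0) rmorph0 mul0r add0r addr0 fmorphV bE.
by field; rewrite !fmorph_eq0 mu0 c0 w0.
Qed.

End DihedralAction.
End Normal.

Section Shape.
Variables (k : closedFieldType) (K : fieldType) (iota : {rmorphism k -> K}).
Local Notation ev := (evalk iota).
Local Notation is_model := (is_model iota).
Local Notation transcendental := (transcendental iota).
Local Notation octavic_model := (octavic_model iota).
Implicit Types (A B C D F G H P Q : {poly k}) (x y z u v w : K).
Hypothesis char0 : [pchar k] =i pred0.

Lemma coef_form_subst_diag G a d j : (j < 9)%N ->
  (form_subst G a 0 0 d)`_j = G`_j * a ^+ j * d ^+ (8 - j).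
Proof.
move=> j9; rewrite /form_subst coef_sum.
rewrite (eq_bigr (fun i : 'I_9 => G`_i * (a ^+ i * (j == i)%:R * d ^+ (8 - i)))); last first.
  move=> i _.
  by rewrite scale0r polyC0 addr0 add0r exprZn -polyC_exp coefZ coefMC coefZ coefXn.
rewrite (bigD1 (Ordinal j9)) //= eqxx mulr1 big1 ?addr0 ?mulrA //.
move=> i ij; have -> : (j == i) = false.
  by apply: contraNF ij => /eqP ij; apply/eqP/val_inj.
by rewrite mulr0 mul0r mulr0.
Qed.

Lemma coef_form_subst_anti G b c j : (j < 9)%N ->
  (form_subst G 0 b c 0)`_j = G`_(8 - j) * b ^+ (8 - j) * c ^+ j.
Proof.
move=> j9; have i9 : (8 - j < 9)%N by lia.
rewrite /form_subst coef_sum.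
rewrite (eq_bigr (fun i : 'I_9 => G`_i * (b ^+ i * (c ^+ (8 - i) * (j == 8 - i)%N%:R)))); last first.
  move=> i _.
  by rewrite scale0r polyC0 addr0 add0r exprZn -polyC_exp coefZ coefCM coefZ coefXn.
have jE : (8 - (8 - j) = j)%N by lia.
rewrite (bigD1 (Ordinal i9)) //= jE eqxx mulr1 big1 ?addr0 ?mulrA //.
move=> i ij; have -> : (j == 8 - i)%N = false.
  apply: contraNF ij => /eqP ij; apply/eqP/val_inj => /=.
  by have := ltn_ord i; lia.
by rewrite !mulr0.
Qed.

Section DihedralAction.
Variables R T : {rmorphism K -> K}.
Hypotheses (Rc : forall c, R (iota c) = iota c) (Tc : forall c, T (iota c) = iota c).
Hypotheses (Rbij : bijective R) (Tbij : bijective T).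
Hypotheses (R3 : forall z, R (R (R z)) = z) (R1 : ~ R =1 id).
Hypothesis TR : forall z, T (R z) = R (R (T z)).

(** Invariance under w -> om w keeps only exponents in one class modulo 3, and
w -> 1/w makes the set of exponents symmetric under i -> 8 - i. As the
form is squarefree, one of the exponents 7 and 8 occurs; with 8 would occur 0,
in another class, so the exponents are 1, 4 and 7. *)
Lemma normal_shape x y F : octavic_model x y F ->
  exists w v a b c, [/\ octavic_model w v (a *: 'X^7 + b *: 'X^4 + c *: 'X),
    a != 0, c != 0 & b != 0 -> a = c].
Proof.
move=> M0; have [w [v [G [om [M Rw om3 om1 Tw]]]]] :=
  normal_coordinate char0 Rc Tc Rbij Tbij R3 R1 TR M0.
have tw := model_transcendental M.1.
have om0 : om != 0 by apply: contra_eq_neq om3 => ->; rewrite expr0n eq_sym oner_neq0.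
have w0 : w != 0.
  by have := @transcendental_lin _ _ iota w 1 0 tw; rewrite oner_neq0 rmorph1 mul1r rmorph0 addr0; apply.
(* R w = om w, written as a Moebius transformation, is diagonal. *)
have [lam E] : exists lam : k, forall j, (j < 9)%N -> G`_j * om ^+ j = lam * G`_j.
  have [a [b [c [d [lam [det0 lam0 cd0 Rw' E]]]]]] := auto_moebius char0 Rc Rbij M.
  move: Rw'; rewrite Rw => /(canLR (divfK cd0)) Rw'.
  have [/eqP c0 /eqP ad /eqP b0] : [/\ c * om = 0, d * om - a = 0 & - b = 0].
    apply: (quad_eq0 tw); rewrite !(rmorphB, rmorphN, rmorphM) /=.
    by move/eqP: Rw'; rewrite -subr_eq0 => /eqP <-; ring.
  move: c0 ad b0; rewrite mulf_eq0 (negPf om0) orbF subr_eq0 oppr_eq0 => /eqP c0 /eqP ad /eqP b0.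
  have d0 : d != 0 by apply: contraNneq det0 => d0; rewrite c0 d0 !mulr0 subrr.
  exists (lam / d ^+ 8) => j j9.
  rewrite b0 c0 in E; have := coef_form_subst_diag G a d j9; rewrite E coefZ -ad exprMn.
  have d8 : d ^+ 8 = d ^+ j * d ^+ (8 - j) by rewrite -exprD subnKC // -ltnS.
  move=> E1; apply: (mulIf (expf_neq0 8 d0)); rewrite [RHS]mulrAC divfK ?expf_neq0 // E1 d8.
  by ring.
(* T w = 1/w is antidiagonal, with equal entries. *)
have [lam' [lam'0 E']] : exists lam : k, [/\ lam != 0 &
    forall j, (j < 9)%N -> G`_(8 - j)%N = lam * G`_j].
  have [a [b [c [d' [lam' [det0 lam'0 cd0 Tw' E']]]]]] := auto_moebius char0 Tc Tbij M.
  move: Tw'; rewrite Tw => /(canLR (divfK cd0))/(canRL (mulVKf w0)) Tw'.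
  have [/eqP a0 /eqP bc /eqP d'0] : [/\ a = 0, b - c = 0 & - d' = 0].
    apply: (quad_eq0 tw); rewrite !(rmorphB, rmorphN) /=.
    by move/eqP: Tw'; rewrite eq_sym -subr_eq0 => /eqP <-; ring.
  move: a0 bc d'0; rewrite subr_eq0 oppr_eq0 => /eqP a0 /eqP bc /eqP d'0.
  have c0 : c != 0 by apply: contraNneq det0 => c0; rewrite a0 bc c0 mul0r mulr0 subrr.
  exists (lam' / c ^+ 8); rewrite mulf_neq0 ?invr_eq0 ?expf_neq0 //; split=> // j j9.
  rewrite a0 d'0 in E'; have := coef_form_subst_anti G b c j9; rewrite E' coefZ bc.
  have c8 : c ^+ 8 = c ^+ (8 - j) * c ^+ j by rewrite -exprD subnK // -ltnS.
  move=> E1; apply: (mulIf (expf_neq0 8 c0)); rewrite [RHS]mulrAC divfK ?expf_neq0 // E1 c8.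
  by ring.
have om2 : om ^+ 2 != 1.
  by apply: contra om1 => /eqP om2; rewrite -om3 exprS om2 mulr1.
have [_ [_ /andP[szG7 szG9]]] := M.
have G8 : G`_8 = 0.
  apply/eqP; apply: contraT => G8.
  have G0 : G`_0 != 0 by rewrite -[0%N]/(8 - 8)%N E' // mulf_neq0.
  case/eqP: om2; have := E 8 isT; have := E 0 isT.
  rewrite expr0 mulr1 -{1}[G`_0]mul1r => /(mulIf G0) <-; rewrite mulrC => /(mulIf G8).
  by rewrite (exprD om 3 5) (exprD om 3 2) om3 !mul1r.
have G0 : G`_0 = 0 by rewrite -[0%N]/(8 - 8)%N E' // G8 mulr0.
have G7 : G`_7 != 0.
  have szG : size G = 8.
    apply/eqP; rewrite eqn_leq szG7 andbT; apply/leq_sizeP => j; rewrite leq_eqVlt => /orP[/eqP<-//|j8].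
    by rewrite nth_default // (leq_trans szG9).
  by have := lead_coef_eq0 G; rewrite lead_coefE szG /= => ->; rewrite -size_poly_eq0 szG.
have G1 : G`_1 != 0 by rewrite -[1%N]/(8 - 7)%N E' // mulf_neq0.
have lamE : lam = om.
  by have := E 1 isT; rewrite expr1 mulrC => /(mulIf G1).
have Gj j : (j < 9)%N -> om ^+ j != om -> G`_j = 0.
  move=> j9; apply: contraNeq => Gj; apply/eqP.
  by have := E j j9; rewrite lamE mulrC => /(mulIf Gj).
have om20 : om ^+ 2 != om.
  apply: contra om1 => /eqP om2'; apply/eqP; apply: (mulfI om0); by rewrite mulr1 -expr2.
have E3 n : om ^+ (3 + n) = om ^+ n by rewrite exprD om3 mul1r.
have om01 : 1 != om by rewrite eq_sym.
have GE : G = G`_7 *: 'X^7 + G`_4 *: 'X^4 + G`_1 *: 'X.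
  apply/polyP => j; rewrite !coefD !coefZ !coefXn coefX.
  have [j9|j9] := ltnP j 9; last first.
    rewrite nth_default ?(leq_trans szG9) //.
    by case: j j9 => [|[|[|[|[|[|[|[|[|j]]]]]]]]] //= _; rewrite !mulr0 !addr0.
  case: j j9 => [|[|[|[|[|[|[|[|[|j]]]]]]]]] //= j9; rewrite ?(mulr0, mulr1, addr0, add0r) //.
  - exact: Gj.
  - by apply: Gj; rewrite ?(E3 0).
  - by apply: Gj; rewrite ?(E3 2).
  - by apply: Gj; rewrite ?(E3 3) ?(E3 0).
rewrite GE in M; exists w, v, G`_7, G`_4, G`_1; split=> // G4.
have := E' 4 isT; rewrite -{1}[G`_(8 - 4)]mul1r => /(mulIf G4) lam'1.
by have := E' 1 isT; rewrite -lam'1 mul1r.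
Qed.

End DihedralAction.
End Shape.

(** * The dihedral group of order 12 *)

(** The relations are those of the square of a rotation of order 6 and of a
reflection; a product of a rotation and a reflection has order 2. *)
Lemma dihedral12_elements : (exists r s : 'D_12, [/\ r * (r * r) = 1, r <> 1 & s * r = r * (r * s)])%g
  /\ (forall a : 'D_12, a ^+ 6 = 1)%g.
Proof.
have := Grp_dihedral (isT : 1 < 6)%N [set: 'D_12]%G.
rewrite homg_refl.
move/esym/existsP => [[x y] /=]; rewrite !xpair_eqE => /and4P[/eqP G /eqP x6 /eqP y2 /eqP xy].
have yV : (y^-1 = y)%g by apply/eqP; rewrite eq_invg_mul -expg2 y2.
have yx : (y * x = x^-1 * y)%g by rewrite -xy conjgE yV -!mulgA -expg2 y2 mulg1.
have nyx : (<[y]> \subset 'N(<[x]>))%g by rewrite norms_cycle xy groupV cycle_id.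
rewrite norm_joinEr // in G.
have yxi i : (y * x ^+ i = x ^- i * y)%g.
  by rewrite -expgVn -xy -conjXg conjgE yV -!mulgA -expg2 y2 mulg1.
split; last first.
  move=> a; have : a \in [set: 'D_12] by rewrite inE.
  rewrite -G => /mulsgP[u v /cycleP[i ->] /cycleP[j ->] ->].
  rewrite -[j]odd_double_half expgD -muln2 mulnC expgM y2 expg1n mulg1.
  case: (odd j) => /=; last first.
    by rewrite expg0 mulg1 -expgM mulnC expgM x6 expg1n.
  rewrite expg1 -[6%N]/(2 * 3)%N expgM expg2 mulgA -(mulgA _ y) yxi mulgA mulgV mul1g.
  by rewrite -expg2 y2 expg1n.
exists (x ^+ 2)%g, y; split.
- by rewrite -!expgD.
- move=> x2; have := card_dihedral (isT : 1 < 6)%N; rewrite -G => card12.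
  have := mul_cardG <[x]>%g <[y]>%g; rewrite card12.
  have ox : (#[x]%g <= 2)%N by rewrite dvdn_leq // order_dvdn x2.
  have oy : (#[y]%g <= 2)%N by rewrite dvdn_leq // order_dvdn y2.
  have : (0 < #|(<[x]> :&: <[y]>)%g|)%N by rewrite cardG_gt0.
  rewrite -!orderE => I0 E.
  have : (6.*2 <= 2 * 2)%N by apply: leq_trans (leq_mul ox oy); rewrite E leq_pmulr.
  by [].
- rewrite yxi mulgA -expgD; congr (_ * _)%g.
  by apply/eqP; rewrite eq_invg_mul -expgD x6.
Qed.

(** * The family of curves and its exceptional members *)

Section Curve.
Variables (k : closedFieldType) (K : fieldType) (iota : {rmorphism k -> K}).
Local Notation ev := (evalk iota).
Local Notation is_model := (is_model iota).
Local Notation transcendental := (transcendental iota).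
Local Notation rat := (rational_in iota).
Local Notation octavic_model := (octavic_model iota).
Implicit Types (A B C D F G H P Q : {poly k}) (x y z u v w : K).
Hypothesis char0 : [pchar k] =i pred0.

(** Rescaling of both generators. *)
Lemma model_scale w v F G m n : is_model w v F -> m != 0 -> n != 0 ->
  ev (iota m * w) G = iota n ^+ 2 * ev w F -> is_model (iota m * w) (iota n * v) G.
Proof.
move=> M m0 n0 E; have tw := model_transcendental M.
have v0 : v != 0.
  by apply/eqP=> v0; case: (model_irrational M); rewrite v0 -(rmorph0 iota); exact: rat_iota.
have tmw : transcendental (iota m * w).
  apply: transcendentalP => c; rewrite -subr_eq0 -rmorphN.
  by apply: transcendental_lin => //; rewrite m0.
apply: (model_change M) => //.
- by apply: ratM => //; [apply: rat_iota | apply: rat_id].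
- rewrite -{2}[w](mulKf (x := iota m)) ?fmorph_eq0 // -fmorphV.
  by apply: ratM => //; [apply: rat_iota | apply: rat_id].
- by rewrite exprMn E; case: M => ->.
- by rewrite mulfK //; apply: rat_iota.
- by rewrite mulf_neq0 ?fmorph_eq0.
Qed.

Definition family (t : k) : {poly k} := 'X * (t *: 'X^6 + t *: 'X^3 + 1).

Lemma ev_family w t : ev w (family t) = w * (iota t * w ^+ 6 + iota t * w ^+ 3 + 1).
Proof. by rewrite rmorphM !rmorphD rmorph1 /= !evZ !rmorphXn /= evX. Qed.

Lemma familyE t : family t = t *: 'X^7 + t *: 'X^4 + 'X.
Proof. by rewrite /family !mulrDr -!scalerAr mulr1 -!exprS. Qed.

Lemma coef_family t i : (family t)`_i = t *+ (i == 7) + t *+ (i == 4) + (i == 1)%:R.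
Proof. by rewrite familyE !coefD !coefZ !coefXn coefX !mulr_natr. Qed.

Lemma size_family t : t != 0 -> size (family t) = 8.
Proof.
move=> t0; rewrite familyE -addrA size_polyDl size_scale ?size_polyXn //.
rewrite ltnS (leq_trans (size_polyD _ _)) // geq_max size_polyX.
by rewrite (leq_trans (size_scale_leq _ _)) ?size_polyXn.
Qed.

Lemma closed_root_Xn (n : nat) (c : k) : (0 < n)%N -> exists m, m ^+ n = c.
Proof.
move=> n0; have [|m] := @closed_rootP _ ('X^n - c%:P) _.
  by rewrite size_XnsubC //; case: n n0.
by move/rootP; rewrite hornerD hornerN hornerXn hornerC => /eqP; rewrite subr_eq0 => /eqP; exists m.
Qed.

Lemma octavic_model_family_neq4 w v t : octavic_model w v (family t) -> t != 4%:R.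
Proof.
move=> [_ [sep _]]; apply: contraTneq sep => ->.
apply/negP => sep; have : (2%:R *: 'X^3 + 1 : {poly k}) ^+ 2 %| family 4%:R.
  apply/dvdpP; exists 'X; rewrite /family; congr (_ * _).
  rewrite -!mul_polyC !polyC_natr; ring.
rewrite separable_nosquare // size_polyDl size_scale ?natr_neq0 ?size_polyXn //.
by rewrite size_poly1.
Qed.

Hypothesis exponent6 :
  forall s : K -> K, is_automorphism iota s -> forall z, iter 6 s z = z.

(** With n^6 = -1, the sixth power of (w, v) -> (n^2 w, n v) is (w, v) -> (w, - v). *)
Lemma no_order12 w v a c : is_model w v (a *: 'X^7 + c *: 'X) -> False.
Proof.
move=> M; have [n nE] := closed_root_Xn (-1) (isT : 0 < 6)%N.
have n0 : n != 0.
  by apply: contra_eq_neq nE => ->; rewrite expr0n /= eq_sym oppr_eq0 oner_neq0.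
have n20 : n ^+ 2 != 0 by rewrite expf_neq0.
have N : is_model (iota (n ^+ 2) * w) (iota n * v) (a *: 'X^7 + c *: 'X).
  apply: model_scale M n20 n0 _; rewrite !rmorphD /= !evZ !rmorphXn /= !evX.
  have -> : (iota n ^+ 2 * w) ^+ 7 = (iota n ^+ 6) ^+ 2 * iota n ^+ 2 * w ^+ 7 by ring.
  by rewrite -[iota n ^+ 6]rmorphXn nE rmorphN1 sqrrN expr1n; ring.
have [s [sA sw sv]] := model_auto_ex M N.
have [f fs fc] := auto_rmorph sA.
have := exponent6 sA v; rewrite -!(eq_iter fs) /= !(fs v) sv.
do 5!rewrite !rmorphM !fc !(fs v) sv /=.
have -> : iota n * (iota n * (iota n * (iota n * (iota n * (iota n * v))))) = iota n ^+ 6 * v by ring.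
rewrite -rmorphXn nE rmorphN1 mulN1r => /eqP; rewrite eq_sym -addr_eq0 -mulr2n -mulr_natl.
rewrite mulf_eq0 (negPf (natrK_neq0 iota char0 1)) /= => /eqP v0.
by case: (model_irrational M); rewrite v0 -(rmorph0 iota); exact: rat_iota.
Qed.

(** With z = w / s and s^3 = 1 / 7, the octavic is z (z^3 - 1) (z^3 + 8) up to a
constant. Its roots are the vertices of a cube, with 0 and infinity opposite to
each other, and z -> (2 z - 2 om) / (- z - 2 om) is a rotation of order 4. The
sixth power of the corresponding automorphism of K moves z. *)
Lemma no_cube w v t : octavic_model w v (family t) -> 8%:R * t + 49%:R = 0 -> False.
Proof.
move=> [M sF] tE.
have nat0 n : n.+1%:R != 0 :> k by apply: natr_neq0.
have [s sE] := closed_root_Xn 7%:R^-1 (isT : 0 < 3)%N.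
have s0 : s != 0.
  by apply: contra_eq_neq sE => ->; rewrite expr0n /= eq_sym invr_eq0.
have [n nE] := closed_root_Xn (- 8%:R / s) (isT : 0 < 2)%N.
have n0 : n != 0.
  apply: contra_eq_neq nE => ->.
  by rewrite expr0n /= eq_sym mulf_neq0 ?invr_eq0 ?oppr_eq0.
pose G : {poly k} := 'X^7 + 7%:R *: 'X^4 - 8%:R *: 'X.
have evG z : ev z G = z ^+ 7 + 7%:R * z ^+ 4 - 8%:R * z.
  by rewrite rmorphB rmorphD /= !evZ !rmorphXn /= !evX !rmorph_nat.
have {}M : is_model (iota s^-1 * w) (iota n * v) G.
  apply: model_scale M _ n0 _; first by rewrite invr_eq0.
  rewrite evG ev_family -rmorphXn nE.
  have -> : t = - (49%:R / 8%:R).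
    by apply: (mulfI (nat0 7)); rewrite mulrN mulrCA divff // mulr1; apply/eqP; rewrite -addr_eq0 tE.
  have r3 : (iota s^-1) ^+ 3 = 7%:R by rewrite -rmorphXn exprVn sE invrK rmorph_nat.
  have n8 : 8%:R != 0 :> K by apply: (natrK_neq0 iota char0).
  have -> : iota (- 8%:R / s) = - 8%:R * iota s^-1 by rewrite rmorphM rmorphN /= rmorph_nat.
  have -> : iota (- (49%:R / 8%:R)) = - (49%:R / 8%:R) by rewrite rmorphN fmorph_div !rmorph_nat.
  set r := iota s^-1 in r3 *.
  have -> : (r * w) ^+ 7 = r * (r ^+ 3) ^+ 2 * w ^+ 7 by ring.
  have -> : (r * w) ^+ 4 = r * r ^+ 3 * w ^+ 4 by ring.
  by rewrite r3; field; rewrite n8 fmorph_eq0 s0.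
have [om om3 om1] : exists2 om : k, om ^+ 3 = 1 & om != 1.
  have [|om] := @closed_rootP _ ('X^2 + ('X + 1%:P) : {poly k}) _.
    by rewrite size_polyDl ?size_XaddC ?size_polyXn.
  move/rootP; rewrite !hornerD hornerXn hornerX hornerC => E; exists om.
    by apply/eqP; rewrite -subr_eq0 -(mulr0 (om - 1)) -E; apply/eqP; ring.
  apply: contra_eq_neq E => ->; rewrite expr1n.
  by have -> : 1 + (1 + 1) = 3%:R :> k by ring.
have om0 : om != 0 by apply: contra_eq_neq om3 => ->; rewrite expr0n /= eq_sym oner_neq0.
move: {w v sF}(iota s^-1 * w) (iota n * v) M => z v M.
have tz := model_transcendental M.
have o3 : iota om ^+ 3 = 1 by rewrite -rmorphXn om3 rmorph1.
have osum : iota om ^+ 2 + iota om + 1 = 0.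
  have o1 : iota om - 1 != 0 by rewrite -(rmorph1 iota) -rmorphB fmorph_eq0 subr_eq0.
  by apply: (mulfI o1); rewrite mulr0 -(subrr 1) -{3}o3; ring.
have det0 : 2%:R * (- 2%:R * om) - (- 2%:R * om) * (- 1) != 0.
  have -> : 2%:R * (- 2%:R * om) - (- 2%:R * om) * (- 1) = - (6%:R * om) by ring.
  by rewrite oppr_eq0 mulf_neq0.
have szG : (size G <= 9)%N.
  rewrite (leq_trans (size_polyD _ _)) // geq_max size_polyN.
  rewrite !(leq_trans (size_scale_leq _ _)) ?size_polyX //.
  rewrite (leq_trans (size_polyD _ _)) // geq_max size_polyXn.
  by rewrite (leq_trans (size_scale_leq _ _)) ?size_polyXn.
have [v1 [G1 [M1 _]]] := model_moebius M szG det0.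
have D0 := transcendental_lin (c := -1) (d := - 2%:R * om) tz.
rewrite oppr_eq0 oner_neq0 in D0; have {D0} := D0 isT.
move: M1; set u := (X in is_model X _ _); set D := (X in X != 0) => M1 D0.
have zu : rat z u.
  have rlin e e' : rat z (iota e * z + iota e').
    by apply: ratD => //; [apply: ratM => //; [apply: rat_iota|apply: rat_id] | apply: rat_iota].
  by apply: ratM => //; apply: ratV.
have uz := model_rat_conv M M1 zu; have tu := model_transcendental M1.
have DE : D = - z - 2%:R * iota om.
  by rewrite /D !(rmorphN, rmorphM, rmorph1) /= rmorph_nat; ring.
have uE : u = (2%:R * z - 2%:R * iota om) / D.
  by rewrite /u -/D; congr (_ / _); rewrite !(rmorphN, rmorphM) /= rmorph_nat; ring.
set o := iota om in o3 osum DE uE.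
have v0 : v != 0.
  by apply/eqP=> v0; case: (model_irrational M); rewrite v0 -(rmorph0 iota); exact: rat_iota.
have {M1} N : is_model u (36%:R * o ^+ 2 / D ^+ 4 * v) G.
  apply: (model_change M) => //.
  - have [v2 _ _] := M; rewrite exprMn v2 !evG uE.
    have E8 : D ^+ 8 != 0 by rewrite expf_neq0.
    apply: (mulIf E8); transitivity (1296%:R * o ^+ 4 * (z ^+ 7 + 7%:R * z ^+ 4 - 8%:R * z)).
      by field.
    (* The two sides differ by the displayed multiple of 1 - om^3. *)
    rewrite -[LHS]addr0 -(mul0r (10368%:R * z * o ^+ 4 + 1296%:R * z ^+ 7 * o)) -(subrr 1) -[X in (1 - X) * _]o3.
    transitivity ((2%:R * z - 2%:R * o) ^+ 7 * D + 7%:R * (2%:R * z - 2%:R * o) ^+ 4 * D ^+ 4 - 8%:R * (2%:R * z - 2%:R * o) * D ^+ 7); last by field.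
    by rewrite DE; ring.
  - have rD : rat z D^-1.
      by apply: ratV => //; apply: ratD => //; [apply: ratM => //; [apply: rat_iota|apply: rat_id] | apply: rat_iota].
    rewrite mulfK //.
    have -> : 36%:R * o ^+ 2 / D ^+ 4 = iota (36%:R * om ^+ 2) * (D^-1 * D^-1 * (D^-1 * D^-1)).
      by rewrite rmorphM rmorphXn /= rmorph_nat -/o; field.
    by apply: ratM => //; [apply: rat_iota | do 2![apply: ratM => //]].
  - rewrite !mulf_neq0 ?invr_eq0 ?expf_neq0 ?fmorph_eq0 //.
    exact: (natrK_neq0 iota char0).
have [s' [sA sz _]] := model_auto_ex M N.
have [f fs fc] := auto_rmorph sA.
have := exponent6 sA z; rewrite -!(eq_iter fs) /=.
have fz : f z = u by rewrite fs.
have D1 : - u - 2%:R * o != 0.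
  have -> : - u - 2%:R * o = (iota (2%:R * om - 2%:R) * z + iota (2%:R * om + 4%:R * om ^+ 2)) / D.
    rewrite !(rmorph_nat, rmorphD, rmorphB, rmorphM, rmorphXn) /= -/o uE DE.
    by field; rewrite -DE.
  rewrite mulf_neq0 ?invr_eq0 //; apply: transcendental_lin => //.
  have -> : 2%:R * om - 2%:R = 2%:R * (om - 1) by ring.
  by rewrite mulf_neq0 ?subr_eq0.
have zo0 : z - o ^+ 2 != 0.
  have := transcendental_lin (c := 1) (d := - om ^+ 2) tz.
  by rewrite oner_neq0 rmorph1 mul1r rmorphN rmorphXn; apply.
(* g is the image of z under the square of the rotation, an involution. *)
pose g := (o ^+ 2 * z + 2%:R * o) / (z - o ^+ 2).
have fu : f u = g.
  rewrite {1}uE DE !(fmorphV, rmorphM, rmorphB, rmorphN, rmorph_nat) /= !fc fz /g.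
  apply/eqP; rewrite eqr_div // -subr_eq0; apply/eqP.
  rewrite uE; apply: (mulIf D0); rewrite mul0r.
  (* The cross-multiplied difference is a multiple of om^2 + om + 1. *)
  transitivity (((4%:R - 2%:R * o) * z ^+ 2 - 4%:R * o ^+ 2 * z - 4%:R * o ^+ 2) * (o ^+ 2 + o + 1)).
    by rewrite DE; field; rewrite -DE.
  by rewrite osum mulr0.
have fo : f o = o by rewrite fc.
have fg w : f ((o ^+ 2 * w + 2%:R * o) / (w - o ^+ 2)) = (o ^+ 2 * f w + 2%:R * o) / (f w - o ^+ 2).
  by rewrite fmorph_div !(rmorph_nat, rmorphXn, rmorphN, rmorphD, rmorphM) /= !fo.
have o0 : 3%:R * o != 0 by rewrite mulf_neq0 ?fmorph_eq0 // (natrK_neq0 iota char0).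
have ffg : f (f g) = z.
  rewrite /g fg fz fg fu /g.
  have o4 : o ^+ 2 * z + 2%:R * o - o ^+ 2 * (z - o ^+ 2) = 3%:R * o.
    have -> : o ^+ 2 * z + 2%:R * o - o ^+ 2 * (z - o ^+ 2) = o ^+ 3 * o + 2%:R * o by ring.
    by rewrite o3; ring.
  have g1 : (o ^+ 2 * z + 2%:R * o) / (z - o ^+ 2) - o ^+ 2 = 3%:R * o / (z - o ^+ 2).
    by rewrite -o4; field.
  have g2 : o ^+ 2 * ((o ^+ 2 * z + 2%:R * o) / (z - o ^+ 2)) + 2%:R * o = 3%:R * o * z / (z - o ^+ 2).
    have -> : 3%:R * o * z = o ^+ 3 * o * z + 2%:R * o * z by rewrite o3; ring.
    by field.
  by rewrite g1 g2 invf_div mulrA divfK // mulrAC mulfV ?mul1r.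
rewrite fz fu ffg fz fu => E.
have : z * (z - o ^+ 2) = o ^+ 2 * z + 2%:R * o by rewrite -{1}E /g divfK.
move/eqP; rewrite -subr_eq0 => /eqP E2.
have [] : [/\ (1 : k) = 0, - 2%:R * om ^+ 2 = 0 & - 2%:R * om = 0].
  apply: (quad_eq0 tz); rewrite -E2 !(rmorph1, rmorph_nat, rmorphXn, rmorphN, rmorphM) /= -/o.
  by ring.
by move/eqP; rewrite oner_eq0.
Qed.
End Curve.

(** * Covariance of transvectants *)

(** The terms in p and in s cancel; this is the antisymmetry that leaves only the
determinant in the substitution rule below. *)
Lemma cross_terms (R : comNzRingType) (V : lmodType R) (a b c d D : R) (p q r s : V) :
  a *: (b *: (D *: p) + d *: (D *: q)) +
  (b *: (c *: (D *: r)) + c *: (d *: (D *: s))) -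
  (b *: (a *: (D *: p) + c *: (D *: q)) +
   (a *: (d *: (D *: r)) + d *: (c *: (D *: s)))) =
  (D * (a * d - b * c)) *: (q - r).
Proof.
rewrite !scalerDr !scalerA.
rewrite !opprD addrACA [X in X + _]addrACA [X in _ + X]addrACA -!scalerBl.
have -> : a * b * D - b * a * D = 0 by ring.
have -> : c * d * D - d * c * D = 0 by ring.
have -> : b * c * D - a * d * D = - (D * (a * d - b * c)) by ring.
have -> : a * d * D - b * c * D = D * (a * d - b * c) by ring.
by rewrite !scale0r add0r addr0 scaleNr scalerN.
Qed.

Section Covariance.
Variable k : fieldType.
Implicit Types (f g : {mpoly k[2]}) (M : 'M[k]_2).
Local Notation dX f := (f^`M(formX)).
Local Notation dZ f := (f^`M(formZ)).

(** The n-th power of the Cayley operator, without the normalizing factor of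
the transvectant. *)
Definition omega (n : nat) f g : {mpoly k[2]} :=
  \sum_(j < n.+1) ((-1) ^+ j * 'C(n, j)%:R) *:
      (pderiv (n - j) j f * pderiv j (n - j) g).

Lemma pderivSl a b f : pderiv a.+1 b f = pderiv a b (dX f).
Proof. by rewrite /pderiv mderivSn. Qed.

Lemma pderivSr a b f : pderiv a b.+1 f = pderiv a b (dZ f).
Proof.
rewrite /pderiv mderivnS; rewrite -!mderivmU1m -!mderivmDm; congr (_^`M[_]).
by rewrite addmA addmC.
Qed.

Lemma omega0 f g : omega 0 f g = f * g.
Proof. by rewrite /omega big_ord1 expr0 mul1r scale1r /pderiv !mderivn0. Qed.

(** Cayley's operator is a difference of two commuting operators; this is Pascal's
rule. *)
Lemma omegaS n f g : omega n.+1 f g = omega n (dX f) (dZ g) - omega n (dZ f) (dX g).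
Proof.
pose t j := (-1) ^+ j *: (pderiv (n.+1 - j) j f * pderiv j (n.+1 - j) g).
have -> : omega n (dX f) (dZ g) = \sum_(j < n.+1) 'C(n, j)%:R *: t j.
  apply: eq_bigr => j _; have jn : (j <= n)%N by rewrite -ltnS.
  by rewrite /t subSn // !pderivSl !pderivSr scalerA mulrC.
have -> : omega n (dZ f) (dX g) = - \sum_(j < n.+1) 'C(n, j)%:R *: t j.+1.
  rewrite -sumrN; apply: eq_bigr => j _; have jn : (j <= n)%N by rewrite -ltnS.
  by rewrite /t subSS !pderivSl !pderivSr scalerA exprS mulN1r mulrN scaleNr opprK mulrC.
rewrite opprK big_ord_recl /= bin0 scale1r.
have -> : omega n.+1 f g = \sum_(j < n.+2) 'C(n.+1, j)%:R *: t j.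
  by apply: eq_bigr => j _; rewrite /t scalerA mulrC.
rewrite big_ord_recl /= bin0 scale1r -addrA; congr (_ + _).
transitivity (\sum_(j < n.+1) ('C(n, j.+1)%:R *: t j.+1 + 'C(n, j)%:R *: t j.+1)).
  by apply: eq_bigr => j _; rewrite /bump /= add1n binS natrD scalerDl.
rewrite big_split /=; congr (_ + _).
rewrite big_ord_recr /= bin_small // scale0r addr0.
by apply: eq_bigr => j _; rewrite /bump /= add1n.
Qed.

Lemma pderiv_is_linear a b : linear (@pderiv k a b).
Proof. by move=> c f g; rewrite /pderiv !mderivmD !mderivmZ. Qed.
HB.instance Definition _ a b := GRing.isLinear.Build k {mpoly k[2]} {mpoly k[2]} _
  (@pderiv k a b) (pderiv_is_linear a b).

Lemma omega_linl n c f1 f2 g : omega n (c *: f1 + f2) g = c *: omega n f1 g + omega n f2 g.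
Proof.
rewrite /omega scaler_sumr -big_split /=; apply: eq_bigr => j _.
by rewrite linearP mulrDl -scalerAl scalerDr !scalerA [c * _]mulrC.
Qed.

Lemma omega_linr n c f g1 g2 : omega n f (c *: g1 + g2) = c *: omega n f g1 + omega n f g2.
Proof.
rewrite /omega scaler_sumr -big_split /=; apply: eq_bigr => j _.
by rewrite linearP mulrDr -scalerAr scalerDr !scalerA [c * _]mulrC.
Qed.

Lemma omegaZl n c f g : omega n (c *: f) g = c *: omega n f g.
Proof.
rewrite /omega scaler_sumr; apply: eq_bigr => j _.
by rewrite linearZ /= -scalerAl !scalerA mulrC.
Qed.

Lemma omegaZr n c f g : omega n f (c *: g) = c *: omega n f g.
Proof.
rewrite /omega scaler_sumr; apply: eq_bigr => j _.
by rewrite linearZ /= -scalerAr !scalerA mulrC.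
Qed.

HB.instance Definition _ M := GRing.LRMorphism.copy (linear_subst M)
  (comp_mpoly [tuple M i formX *: 'X_formX + M i formZ *: 'X_formZ | i < 2]).

Lemma linear_substP M c f g :
  linear_subst M (c *: f + g) = c *: linear_subst M f + linear_subst M g.
Proof. exact: linearP. Qed.

Lemma linear_substX M i : linear_subst M 'X_i = M i formX *: 'X_formX + M i formZ *: 'X_formZ.
Proof. by rewrite /linear_subst comp_mpolyXU -tnth_nth tnth_mktuple. Qed.

Lemma ord2 (i : 'I_2) : i = formX \/ i = formZ.
Proof. by case: i => [[|[|]]] // ?; [left|right]; apply/val_inj. Qed.

Lemma mderivXU (i j : 'I_2) : ('X_i : {mpoly k[2]})^`M(j) = (i == j)%:R.
Proof.
rewrite mderivX mnm1E; have [->|_] := eqVneq i j; last by rewrite scale0r.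
have -> : (U_(j) - U_(j) = 0)%MM by apply/mnmP => l; rewrite mnmBE subnn mnm0E.
by rewrite mpolyX0 scale1r.
Qed.

(** The chain rule. *)
Lemma mderiv_subst M (j : 'I_2) f :
  (linear_subst M f)^`M(j) =
    M formX j *: linear_subst M (dX f) + M formZ j *: linear_subst M (dZ f).
Proof.
pose P f := (linear_subst M f)^`M(j) =
    M formX j *: linear_subst M (dX f) + M formZ j *: linear_subst M (dZ f).
have PM f1 f2 : P f1 -> P f2 -> P (f1 * f2).
  rewrite /P => E1 E2; rewrite rmorphM mderivM E1 E2 !mderivM !rmorphD !rmorphM /=.
  rewrite -!mul_mpolyC; move: (_%:MP) (_%:MP) => a b; ring.
have P1 : P 1.
  by rewrite /P rmorph1 -mpolyC1 !mderivC !rmorph0 !scaler0 addr0.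
have PX i : P 'X_i.
  rewrite /P linear_substX mderivD !mderivZ !mderivXU.
  by case: (ord2 i) => ->; case: (ord2 j) => ->; rewrite !(eqxx, rmorph1, rmorph0, scaler0, addr0, add0r).
have Pm m : P 'X_[m].
  rewrite mpolyXE_id; elim/big_ind: _; [exact: P1 | exact: PM | move=> i _].
  elim: (m i) => [|n IH]; first by rewrite expr0; exact: P1.
  by rewrite exprS; apply: (PM _ _ (PX i) IH).
elim/mpolyind: f => [|c m f _ _ IH]; first by rewrite !(mderiv0, rmorph0, scaler0) addr0.
rewrite !(linear_substP, mderivD, mderivZ) IH (Pm m) !scalerDr !scalerA.
by rewrite addrACA ![c * _]mulrC.
Qed.

Lemma det_mx2 M : \det M = M formX formX * M formZ formZ - M formX formZ * M formZ formX.
Proof.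
rewrite (expand_det_row _ formX) !big_ord_recl big_ord0 addr0 /cofactor !det_mx11 !mxE /=.
rewrite /bump /= !addn0 expr0 expr1 !mul1r mulN1r mulrN.
by congr (M _ _ * M _ _ - M _ _ * M _ _); apply/val_inj.
Qed.

(** Equivariance of Cayley's operator, by the recursion omegaS and the chain rule. *)
Lemma omega_subst M n f g :
  omega n (linear_subst M f) (linear_subst M g) = \det M ^+ n *: linear_subst M (omega n f g).
Proof.
elim: n f g => [|n IH] f g; first by rewrite !omega0 expr0 scale1r rmorphM.
rewrite !omegaS !mderiv_subst (_ : linear_subst M (_ - _) =
  linear_subst M (omega n (dX f) (dZ g)) - linear_subst M (omega n (dZ f) (dX g))); last exact: linearB.
rewrite !(omega_linl, omega_linr, omegaZl, omegaZr) !IH exprSr.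
set D := \det M ^+ n; rewrite det_mx2.
exact: cross_terms.
Qed.

Lemma linear_substZ M c f : linear_subst M (c *: f) = c *: linear_subst M f.
Proof. exact: comp_mpolyZ. Qed.

Lemma transvectantE m p n f g :
  transvectant m p n f g = (((m - n)`! * (p - n)`!)%:R / (m`! * p`!)%:R) *: omega n f g.
Proof. by []. Qed.

Lemma transvectant_subst M m p n f g :
  transvectant m p n (linear_subst M f) (linear_subst M g) =
    \det M ^+ n *: linear_subst M (transvectant m p n f g).
Proof. by rewrite !transvectantE omega_subst linear_substZ !scalerA mulrC. Qed.

Lemma mcoeff0_subst M f : (linear_subst M f)@_0%MM = f@_0%MM.
Proof.
elim/mpolyind: f => [|c m f _ _ IH]; first by rewrite rmorph0.
rewrite linear_substP !mcoeffD !mcoeffZ IH; congr (_ * _ + _).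
rewrite mpolyXE_id !rmorph_prod /=; apply: eq_bigr => i _.
rewrite !rmorphXn /= linear_substX; congr (_ ^+ _).
have X0 (j : 'I_2) : 'X_j@_0%MM = 0 :> k.
  by rewrite mcoeffX; case: eqP => // /mnmP/(_ j); rewrite mnm1E eqxx mnm0E.
by rewrite mcoeffD !mcoeffZ !X0 !mulr0 addr0.
Qed.

Lemma J2_subst M f : J2 (linear_subst M f) = \det M ^+ 8 * J2 f.
Proof. by rewrite /J2 transvectant_subst mcoeffZ mcoeff0_subst mulrCA. Qed.

Lemma kappa_subst M f : cov_kappa (linear_subst M f) = \det M ^+ 6 *: linear_subst M (cov_kappa f).
Proof. exact: transvectant_subst. Qed.

Lemma transvectantZ m p n c e f g :
  transvectant m p n (c *: f) (e *: g) = (c * e) *: transvectant m p n f g.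
Proof. by rewrite !transvectantE omegaZl omegaZr !scalerA; congr (_ *: _); ring. Qed.

Lemma cov_h_subst M f : cov_h (linear_subst M f) = \det M ^+ 14 *: linear_subst M (cov_h f).
Proof.
by rewrite /cov_h !kappa_subst transvectantZ transvectant_subst scalerA -!exprD.
Qed.

Lemma J4_subst M f : J4 (linear_subst M f) = \det M ^+ 16 * J4 f.
Proof.
rewrite /J4 !kappa_subst transvectantZ transvectant_subst scalerA -!exprD mcoeffZ mcoeff0_subst.
by rewrite mulrCA.
Qed.

Lemma J6_subst M f : J6 (linear_subst M f) = \det M ^+ 24 * J6 f.
Proof.
rewrite /J6 kappa_subst cov_h_subst transvectantZ transvectant_subst scalerA -!exprD mcoeffZ mcoeff0_subst.
by rewrite mulrCA.
Qed.

End Covariance.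

(** * Transvectants on coefficients *)

(** The structure constants of the n-th transvection of forms of degrees m and p
on monomials. They are integers, which gives invariants with integer
coefficients; coefficients of forms are functions on nat, of which only the
values up to the degree matter. *)
Definition omega_const (m p n i j : nat) : int :=
  \sum_(l < n.+1) (-1) ^+ l * ('C(n, l)%:R * ((i ^_ (n - l))%:R * ((m - i) ^_ l)%:R)
     * ((j ^_ l)%:R * ((p - j) ^_ (n - l))%:R)).

Definition omega_coef (R : comNzRingType) (m p n : nat) (a b : nat -> R) (e : nat) : R :=
  \sum_(i < m.+1 | (i <= e + n <= i + p)%N)
     (a i * b (e + n - i)%N) *~ omega_const m p n i (e + n - i).

Section Coefficients.
Variable k : fieldType.
Implicit Types (f g : {mpoly k[2]}) (a b : nat -> k).

Definition monom2 (i j : nat) : {mpoly k[2]} := 'X_formX ^+ i * 'X_formZ ^+ j.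

Definition binform (m : nat) a : {mpoly k[2]} := \sum_(i < m.+1) a i *: monom2 i (m - i).

Lemma monom2E i j : monom2 i j = 'X_[U_(formX) *+ i + U_(formZ) *+ j].
Proof. by rewrite mpolyXD -!mpolyXn. Qed.

Lemma mnmXE i j : ((U_(formX) *+ i + U_(formZ) *+ j) formX = i)%MM.
Proof. by rewrite mnmDE !mulmnE !mnm1E eqxx mul1n addn0. Qed.
Lemma mnmZE i j : ((U_(formX) *+ i + U_(formZ) *+ j) formZ = j)%MM.
Proof. by rewrite mnmDE !mulmnE !mnm1E eqxx mul1n. Qed.

Lemma mnm2P (m m' : 'X_{1..2}) : m formX = m' formX -> m formZ = m' formZ -> m = m'.
Proof. by move=> EX EZ; apply/mnmP => i; case: (ord2 i) => ->. Qed.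

Lemma pderiv_monom2 (r s i j : nat) :
  pderiv r s (monom2 i j) = ((i ^_ r)%:R * (j ^_ s)%:R) *: monom2 (i - r) (j - s).
Proof.
rewrite /pderiv !monom2E mderivnX mderivmZ mderivnX scalerA mnmXE.
have -> : ((U_(formX) *+ i + U_(formZ) *+ j - U_(formX) *+ r) = U_(formX) *+ (i - r) + U_(formZ) *+ j)%MM.
  by apply: mnm2P; rewrite mnmBE !(mnmXE, mnmZE) !mulmnE !mnm1E ?mul1n ?mul0n ?subn0.
rewrite mnmZE; congr (_ *: 'X_[_]).
by apply: mnm2P; rewrite mnmBE !(mnmXE, mnmZE) !mulmnE !mnm1E ?mul1n ?mul0n ?subn0.
Qed.

Lemma monom2M i j i' j' : monom2 i j * monom2 i' j' = monom2 (i + i') (j + j').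
Proof. by rewrite /monom2 mulrACA -!exprD. Qed.

(** A monomial that a derivative kills has a vanishing falling factorial, so the
truncated subtractions in the exponents are harmless. *)
Lemma omega_monom2 m p n i j : (i <= m)%N -> (j <= p)%N ->
  omega n (monom2 i (m - i)) (monom2 j (p - j)) =
  (omega_const m p n i j)%:~R *: monom2 (i + j - n) (m + p - n.*2 - (i + j - n)).
Proof.
move=> im jp; rewrite /omega /omega_const rmorph_sum /= scaler_suml; apply: eq_bigr => l _.
have ln : (l <= n)%N by rewrite -ltnS.
rewrite !pderiv_monom2 -scalerAl -scalerAr !scalerA monom2M.
rewrite !rmorphM rmorphXn rmorphN1 /= !rmorph_nat.
have [c1|c1] := leqP (n - l) i; last by rewrite (ffact_small c1) !(mul0r, mulr0, scale0r).
have [c2|c2] := leqP l (m - i); last by rewrite (ffact_small c2) !(mul0r, mulr0, scale0r).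
have [c3|c3] := leqP l j; last by rewrite (ffact_small c3) !(mul0r, mulr0, scale0r).
have [c4|c4] := leqP (n - l) (p - j); last by rewrite (ffact_small c4) !(mul0r, mulr0, scale0r).
congr (_ *: monom2 _ _); [by rewrite !mulrA | lia | lia].
Qed.

Lemma omega_const_small m p n i j : (i <= m)%N -> (j <= p)%N ->
  ~~ (n <= i + j <= m + p - n)%N -> omega_const m p n i j = 0.
Proof.
move=> im jp H; rewrite /omega_const big1 // => l _.
have ln : (l <= n)%N by rewrite -ltnS.
have [c1|c1] := leqP (n - l) i; last by rewrite (ffact_small c1) !(mul0r, mulr0, scale0r).
have [c2|c2] := leqP l (m - i); last by rewrite (ffact_small c2) !(mul0r, mulr0, scale0r).
have [c3|c3] := leqP l j; last by rewrite (ffact_small c3) !(mul0r, mulr0, scale0r).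
have [c4|c4] := leqP (n - l) (p - j); last by rewrite (ffact_small c4) !(mul0r, mulr0, scale0r).
by exfalso; move: H; lia.
Qed.

Lemma omega_suml n (I : Type) (r : seq I) (P : pred I) (F : I -> {mpoly k[2]}) g :
  omega n (\sum_(i <- r | P i) F i) g = \sum_(i <- r | P i) omega n (F i) g.
Proof.
elim/big_rec2: _ => [|i x y _ <-]; first by have := omegaZl n 0 0 g; rewrite !scale0r.
by rewrite -{1}[F i]scale1r omega_linl scale1r.
Qed.

Lemma omega_sumr n (I : Type) (r : seq I) (P : pred I) (F : I -> {mpoly k[2]}) g :
  omega n g (\sum_(i <- r | P i) F i) = \sum_(i <- r | P i) omega n g (F i).
Proof.
elim/big_rec2: _ => [|i x y _ <-]; first by have := omegaZr n 0 g 0; rewrite !scale0r.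
by rewrite -{1}[F i]scale1r omega_linr scale1r.
Qed.

(** The double sum over pairs of monomials is collected by the exponent
e = i + j - n of the product. *)
Lemma omega_binform m p n a b : (n <= m)%N -> (n <= p)%N ->
  omega n (binform m a) (binform p b) = binform (m + p - n.*2) (omega_coef m p n a b).
Proof.
move=> nm np; set D := (m + p - n.*2)%N.
rewrite /binform omega_suml.
under [RHS]eq_bigr => e _ do rewrite /omega_coef big_mkcond /= scaler_suml.
rewrite [RHS]exchange_big /=; apply: eq_bigr => i _.
have im : (i <= m)%N by rewrite -ltnS.
rewrite omegaZl omega_sumr scaler_sumr.
(* Outside this range the structure constants vanish. *)
pose P (j : nat) := (n <= i + j <= n + D)%N.
rewrite (bigID (fun j : 'I_p.+1 => P j)) /= [X in _ + X]big1 ?addr0; last first.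
  move=> j Pj; have jp : (j <= p)%N by rewrite -ltnS.
  rewrite omegaZr omega_monom2 // omega_const_small ?scale0r ?scaler0 //.
  by move: Pj; rewrite /P /D; lia.
rewrite (reindex_onto (fun e : 'I_D.+1 => inord (e + n - i) : 'I_p.+1)
   (fun j : 'I_p.+1 => inord (i + j - n) : 'I_D.+1)) /=; last first.
  move=> j /andP[Pj1 Pj2]; apply/val_inj => /=; rewrite (@inordK D); last by lia.
  have -> : (i + j - n + n - i)%N = j by lia.
  by rewrite inord_val.
rewrite big_mkcond /=; apply: eq_bigr => e _.
have eD : (e <= D)%N by rewrite -ltnS.
have [/andP[c1 c2]|c] := boolP (i <= e + n <= i + p)%N; last first.
  rewrite scale0r; case: ifP => // /andP[/andP[Pe1 Pe2] /eqP/(congr1 val) /=].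
  move: (inord (e + n - i) : 'I_p.+1) Pe1 Pe2 => v Pe1 Pe2; rewrite inordK; last by lia.
  by have := ltn_ord v; move: c Pe1 => /negP c Pe1 vp E; case: c; lia.
rewrite inordK; last by lia.
have -> : (inord (i + (e + n - i) - n) : 'I_D.+1) = e.
  by rewrite -[RHS]inord_val; congr inord; lia.
rewrite eqxx andbT /P subnKC // leq_addl addnC leq_add2l eD /=.
rewrite omegaZr omega_monom2 //; last by lia.
have -> : (i + (n + e - i) - n)%N = e by lia.
by rewrite -/D !scalerA mulrzr.
Qed.

Lemma binform0 a : (binform 0 a)@_0%MM = a 0%N.
Proof.
by rewrite /binform big_ord1 /monom2 !expr0 mulr1 mcoeffZ mcoeff1 eqxx mulr1.
Qed.

Lemma binform_octavic (F : {poly k}) : octavic_of_poly F = binform 8 (fun i => F`_i).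
Proof. by []. Qed.

Lemma mcoeff_monom2 i j m : (monom2 i j)@_m = ((m formX == i) && (m formZ == j))%:R.
Proof.
rewrite monom2E mcoeffX; congr (_%:R); congr nat_of_bool.
apply/eqP/andP => [<-|[/eqP<- /eqP<-]]; first by rewrite mnmXE mnmZE.
by apply: mnm2P; rewrite !(mnmXE, mnmZE).
Qed.

Lemma mdeg2 (m : 'X_{1..2}) : mdeg m = (m formX + m formZ)%N.
Proof.
rewrite mdegE !big_ord_recl big_ord0 addn0; congr (m _ + m _)%N; exact/val_inj.
Qed.

Lemma homog_binform f : f \is 8.-homog -> f = binform 8 (fun i => octavic_coef f (inord i)).
Proof.
move=> hf; apply/mpolyP => m; rewrite /binform raddf_sum /=.
have [E|E] := eqVneq (mdeg m) 8; last first.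
  rewrite (dhomog_nemf_coeff hf) // big1 // => i _; rewrite mcoeffZ mcoeff_monom2.
  case: andP => [[/eqP mX /eqP mZ]|_]; last by rewrite mulr0.
  by case/eqP: E; rewrite mdeg2 mX mZ subnKC // -ltnS.
move: E; rewrite mdeg2 => E; have mX : (m formX < 9)%N by lia.
rewrite (bigD1 (Ordinal mX)) //= big1 ?addr0.
  have mZ : (8 - m formX = m formZ)%N by lia.
  rewrite mcoeffZ mcoeff_monom2 eqxx /= mZ eqxx mulr1.
  rewrite /octavic_coef inordK // mZ; congr (f@__).
  by apply: mnm2P; rewrite multinomE (tnth_nth 0%N).
move=> i ij; rewrite mcoeffZ mcoeff_monom2; case: eqP => [Ei|_]; last by rewrite mulr0.
by case/eqP: ij; apply/val_inj.
Qed.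

End Coefficients.

Lemma bin_values :
  (('C(8, 0) = 1)%N * ('C(8, 1) = 8)%N * ('C(8, 2) = 28)%N * ('C(8, 3) = 56)%N
   * ('C(8, 4) = 70)%N * ('C(8, 5) = 56)%N * ('C(8, 6) = 28)%N * ('C(8, 7) = 8)%N
   * ('C(8, 8) = 1)%N * ('C(6, 0) = 1)%N * ('C(6, 1) = 6)%N * ('C(6, 2) = 15)%N
   * ('C(6, 3) = 20)%N * ('C(6, 4) = 15)%N * ('C(6, 5) = 6)%N * ('C(6, 6) = 1)%N
   * ('C(4, 0) = 1)%N * ('C(4, 1) = 4)%N * ('C(4, 2) = 6)%N * ('C(4, 3) = 4)%N
   * ('C(4, 4) = 1)%N * ('C(2, 0) = 1)%N * ('C(2, 1) = 2)%N * ('C(2, 2) = 1)%N)%type.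
Proof. by []. Qed.

(** The falling factorials are expanded into products of small factors, so that the
ring normalization works with binary integers and never evaluates a large
natural number. *)
Ltac compute_omega_const :=
  rewrite /omega_const !big_ord_recl big_ord0 /= /bump /= !bin_values;
  rewrite !ffact_prod !big_ord_recl !big_ord0 /= /bump /=;
  rewrite ?(add1n, addn0, subSS, subn0, sub0n) !natrM; ring.

Lemma omega_const_88817 : omega_const 8 8 8 1 7 = - (8 * (72 * 70) ^+ 2).
Proof. compute_omega_const. Qed.
Lemma omega_const_88871 : omega_const 8 8 8 7 1 = - (8 * (72 * 70) ^+ 2).
Proof. compute_omega_const. Qed.
Lemma omega_const_88844 : omega_const 8 8 8 4 4 = 70 * 24 ^+ 4.
Proof. compute_omega_const. Qed.
Lemma omega_const_88617 : omega_const 8 8 6 1 7 = - (2 * 2520 ^+ 2).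
Proof. compute_omega_const. Qed.
Lemma omega_const_88671 : omega_const 8 8 6 7 1 = - (2 * 2520 ^+ 2).
Proof. compute_omega_const. Qed.
Lemma omega_const_88644 : omega_const 8 8 6 4 4 = - (50 * 288 ^+ 2).
Proof. compute_omega_const. Qed.
Lemma omega_const_44222 : omega_const 4 4 2 2 2 = - 24.
Proof. compute_omega_const. Qed.
Lemma omega_const_44422 : omega_const 4 4 4 2 2 = 96.
Proof. compute_omega_const. Qed.

(** * Invariants with integer coefficients *)

Section Tform.
Variables (R : comNzRingType).
Implicit Types (a b : nat -> R).

Lemma eq_omega_coef m p n a a' b b' e : a =1 a' -> b =1 b' ->
  omega_coef m p n a b e = omega_coef m p n a' b' e.
Proof. by move=> Ea Eb; apply: eq_bigr => i _; rewrite Ea Eb. Qed.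

Definition kappa_coef a := omega_coef 8 8 6 a a.
Definition h_coef a := omega_coef 4 4 2 (kappa_coef a) (kappa_coef a).
(** J2, J4 and J6 of the form with coefficients a, up to rational factors. *)
Definition inv2 a : R := omega_coef 8 8 8 a a 0.
Definition inv4 a : R := omega_coef 4 4 4 (kappa_coef a) (kappa_coef a) 0.
Definition inv6 a : R := omega_coef 4 4 4 (kappa_coef a) (h_coef a) 0.

Lemma eq_invs a a' : a =1 a' -> [/\ inv2 a = inv2 a', inv4 a = inv4 a' & inv6 a = inv6 a'].
Proof.
move=> E; have Ek : kappa_coef a =1 kappa_coef a' by move=> e; apply: eq_omega_coef.
have Eh : h_coef a =1 h_coef a' by move=> e; apply: eq_omega_coef.
by split; apply: eq_omega_coef.
Qed.
End Tform.

Section TformMorph.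
Variables (R S : comNzRingType) (f : {rmorphism R -> S}).
Implicit Types (a b : nat -> R).

Lemma rmorph_omega_coef m p n a b e :
  f (omega_coef m p n a b e) = omega_coef m p n (fun i => f (a i)) (fun i => f (b i)) e.
Proof. by rewrite /omega_coef rmorph_sum; apply: eq_bigr => i _; rewrite rmorphMz rmorphM. Qed.

Lemma rmorph_invs a : [/\ f (inv2 a) = inv2 (fun i => f (a i)),
  f (inv4 a) = inv4 (fun i => f (a i)) & f (inv6 a) = inv6 (fun i => f (a i))].
Proof.
have Ek e : f (kappa_coef a e) = kappa_coef (fun i => f (a i)) e by apply: rmorph_omega_coef.
have Eh e : f (h_coef a e) = h_coef (fun i => f (a i)) e.
  by rewrite /h_coef rmorph_omega_coef; apply: eq_omega_coef.
by split; rewrite rmorph_omega_coef //; apply: eq_omega_coef.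
Qed.
End TformMorph.

Section Homog.
Variables (n : nat) (R : comNzRingType).
Implicit Types (a b : nat -> {mpoly R[n]}).

Lemma omega_coef_homog m p q a b da db e :
    (forall i, a i \is da.-homog) -> (forall i, b i \is db.-homog) ->
  omega_coef m p q a b e \is (da + db)%N.-homog.
Proof.
move=> ha hb; apply: rpred_sum => i _.
by rewrite -mulrzr; rewrite mulrzr; apply: rpredMz; apply: dhomogM.
Qed.

Lemma inv_homog a : (forall i, a i \is 1.-homog) ->
  [/\ inv2 a \is 2.-homog, inv4 a \is 4.-homog & inv6 a \is 6.-homog].
Proof.
move=> ha; have hk e : kappa_coef a e \is 2.-homog := @omega_coef_homog 8 8 6 a a 1 1 e ha ha.
have hh e : h_coef a e \is 4.-homog := @omega_coef_homog 4 4 2 _ _ 2 2 e hk hk.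
split; [exact: (@omega_coef_homog 8 8 8 a a 1 1) | exact: (@omega_coef_homog 4 4 4 _ _ 2 2) |
  exact: (@omega_coef_homog 4 4 4 _ _ 2 4)].
Qed.
End Homog.

Section Invariants.
Variable k : fieldType.
Implicit Types (f g : {mpoly k[2]}) (a b : nat -> k).

Definition tnorm (m p n : nat) : k := ((m - n)`! * (p - n)`!)%:R / (m`! * p`!)%:R.

Lemma transvectant_binform m p n a b : (n <= m)%N -> (n <= p)%N ->
  transvectant m p n (binform m a) (binform p b) =
    tnorm m p n *: binform (m + p - n.*2) (omega_coef m p n a b).
Proof. by move=> nm np; rewrite transvectantE omega_binform. Qed.

Definition const2 : k := (2 ^ 2 * 5 * 7)%:R * tnorm 8 8 8.
Definition const4 : k := (2 ^ 9 * 3 * 7 ^ 4)%:R * (tnorm 8 8 6 ^+ 2 * tnorm 4 4 4).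
Definition const6 : k := (2 ^ 14 * 3 ^ 2 * 7 ^ 6)%:R * (tnorm 8 8 6 ^+ 3 * tnorm 4 4 2 * tnorm 4 4 4).

Lemma kappa_binform a : cov_kappa (binform 8 a) = tnorm 8 8 6 *: binform 4 (kappa_coef a).
Proof. exact: transvectant_binform. Qed.

Lemma h_binform a :
  cov_h (binform 8 a) = (tnorm 8 8 6 ^+ 2 * tnorm 4 4 2) *: binform 4 (h_coef a).
Proof.
by rewrite /cov_h kappa_binform transvectantZ transvectant_binform // scalerA expr2.
Qed.

Lemma J2_binform a : J2 (binform 8 a) = const2 * inv2 a.
Proof. by rewrite /J2 transvectant_binform // mcoeffZ binform0 mulrA. Qed.

Lemma J4_binform a : J4 (binform 8 a) = const4 * inv4 a.
Proof.
rewrite /J4 kappa_binform transvectantZ transvectant_binform // scalerA mcoeffZ binform0.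
by rewrite /const4 expr2 !mulrA.
Qed.

Lemma J6_binform a : J6 (binform 8 a) = const6 * inv6 a.
Proof.
rewrite /J6 kappa_binform h_binform transvectantZ transvectant_binform // scalerA mcoeffZ binform0.
by rewrite /const6 exprS !mulrA.
Qed.

(** The coefficients of the generic octavic; only the indices 0 to 8 occur. *)
Definition generic_coef (i : nat) : {mpoly int[9]} := 'X_(inord i).

Lemma octavic_eval_gen f : let a i := octavic_coef f (inord i) in
  [/\ octavic_eval (inv2 generic_coef) f = inv2 a, octavic_eval (inv4 generic_coef) f = inv4 a
    & octavic_eval (inv6 generic_coef) f = inv6 a].
Proof.
move=> a; have [E2 E4 E6] := rmorph_invs (mmap (intmul (1 : k)) (octavic_coef f)) generic_coef.
have E i : mmap (intmul (1 : k)) (octavic_coef f) (generic_coef i) = a i by rewrite /generic_coef mmapX mmap1U.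
by have [<- <- <-] := eq_invs E; split.
Qed.

(** The image of each variable is homogeneous of degree 1. *)
Lemma linear_subst_homog M d f : f \is d.-homog -> linear_subst M f \is d.-homog.
Proof.
move=> hf; rewrite [f]mpolyE /linear_subst raddf_sum /=; rewrite big_seq.
apply: rpred_sum => m mf; rewrite comp_mpolyZ; apply: rpredZ.
have dm : mdeg m = d by apply: (dhomog_mf hf).
have hlin (i : 'I_2) : M i formX *: 'X_formX + M i formZ *: 'X_formZ \is 1.-homog.
  by apply: rpredD; apply: rpredZ; rewrite dhomogX /= mdeg1.
rewrite comp_mpolyX !big_ord_recl big_ord0 mulr1 !tnth_mktuple.
rewrite -dm mdegE !big_ord_recl big_ord0 addn0.
by apply: dhomogM; rewrite -[X in X.-homog]mul1n; apply: dhomogMn; apply: hlin.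
Qed.

Hypothesis char0 : [pchar k] =i pred0.

Lemma tnorm_neq0 m p n : tnorm m p n != 0.
Proof.
by rewrite mulf_neq0 ?invr_eq0 // (natk_neq0 char0) // muln_gt0 !fact_gt0.
Qed.

Lemma const2_neq0 : const2 != 0.
Proof. by apply: mulf_neq0 (tnorm_neq0 _ _ _); apply: (natk_neq0 char0). Qed.
Lemma const4_neq0 : const4 != 0.
Proof.
apply: mulf_neq0; first by apply: (natk_neq0 char0); rewrite !muln_gt0 ?expn_gt0.
by apply: mulf_neq0; [apply: expf_neq0|]; apply: tnorm_neq0.
Qed.
Lemma const6_neq0 : const6 != 0.
Proof.
apply: mulf_neq0; first by apply: (natk_neq0 char0); rewrite !muln_gt0 ?expn_gt0.
apply: mulf_neq0; last exact: tnorm_neq0.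
by apply: mulf_neq0; [apply: expf_neq0|]; apply: tnorm_neq0.
Qed.

(** The invariants are nonzero multiples of J2, J4 and J6, whose covariance is
known. *)
Lemma invs_SL2 M f : \det M = 1 -> f \is 8.-homog ->
  [/\ octavic_eval (inv2 generic_coef) (linear_subst M f) = octavic_eval (inv2 generic_coef) f,
      octavic_eval (inv4 generic_coef) (linear_subst M f) = octavic_eval (inv4 generic_coef) f
    & octavic_eval (inv6 generic_coef) (linear_subst M f) = octavic_eval (inv6 generic_coef) f].
Proof.
move=> M1 hf; have hMf := linear_subst_homog M hf.
have E g : g \is 8.-homog -> [/\ J2 g = const2 * octavic_eval (inv2 generic_coef) g,
    J4 g = const4 * octavic_eval (inv4 generic_coef) g & J6 g = const6 * octavic_eval (inv6 generic_coef) g].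
  move=> hg; have [e2 e4 e6] := octavic_eval_gen g; have gE := homog_binform hg.
  split; rewrite {1}gE; [rewrite e2; exact: J2_binform | rewrite e4; exact: J4_binform |
    rewrite e6; exact: J6_binform].
have [E2 E4 E6] := E _ hf; have [F2 F4 F6] := E _ hMf.
split; [apply: (mulfI const2_neq0) | apply: (mulfI const4_neq0) | apply: (mulfI const6_neq0)].
- by rewrite -E2 -F2 J2_subst M1 expr1n mul1r.
- by rewrite -E4 -F4 J4_subst M1 expr1n mul1r.
- by rewrite -E6 -F6 J6_subst M1 expr1n mul1r.
Qed.

Lemma octavic_evalM I J f : octavic_eval (I * J) f = octavic_eval I f * octavic_eval J f.
Proof. exact: rmorphM. Qed.

Lemma octavic_invariant6 : octavic_invariant k 6 (inv6 generic_coef).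
Proof.
split; last by move=> M f M1 hf; case: (invs_SL2 M1 hf).
by have [] : [/\ inv2 generic_coef \is 2.-homog, inv4 generic_coef \is 4.-homog & inv6 generic_coef \is 6.-homog]
  by apply: inv_homog => i; rewrite dhomogX /= mdeg1.
Qed.

Lemma octavic_invariant24 : octavic_invariant k 6 (inv2 generic_coef * inv4 generic_coef).
Proof.
split.
  have [h2 h4 _] : [/\ inv2 generic_coef \is 2.-homog, inv4 generic_coef \is 4.-homog & inv6 generic_coef \is 6.-homog].
    by apply: inv_homog => i; rewrite dhomogX /= mdeg1.
  exact: (dhomogM h2 h4).
move=> M f M1 hf; have [e2 e4 _] := invs_SL2 M1 hf.
rewrite (octavic_evalM (inv2 generic_coef) (inv4 generic_coef) f) (octavic_evalM (inv2 generic_coef) (inv4 generic_coef)).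
by congr (_ * _); [exact: e2 | exact: e4].
Qed.

End Invariants.

(** * Invariants of the family *)

Local Opaque omega_const.
Section FamilyInvariants.
Variable k : closedFieldType.
Hypothesis char0 : [pchar k] =i pred0.
Implicit Types (t : k) (F G : {poly k}).

Let kappa2 t : k := - (4%:R * 2520%:R ^+ 2) * t - 50%:R * 288%:R ^+ 2 * t ^+ 2.

Lemma kappa_family t e : (e < 5)%N ->
  kappa_coef (fun i => (family t)`_i) e = if e == 2%N then kappa2 t else 0.
Proof.
move=> e5; rewrite /kappa_coef (eq_omega_coef _ _ _ _ (coef_family t) (coef_family t)).
rewrite /omega_coef big_mkcond /= !big_ord_recl big_ord0 /= /bump /=.
case: e e5 => [|[|[|[|[|e]]]]] // _; rewrite /= ?(mulr0n, mulr1n, mul0r, mulr0, mul0rz, addr0, add0r, mul1r, mulr1) //.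
rewrite ?(addSn, add0n, addn0, subSS, subn0).
rewrite omega_const_88617 omega_const_88671 omega_const_88644 /kappa2.
by ring.
Qed.

Lemma inv2_family t : inv2 (fun i => (family t)`_i) =
  - (16%:R * (72%:R * 70%:R) ^+ 2) * t + 70%:R * 24%:R ^+ 4 * t ^+ 2.
Proof.
rewrite /inv2 (eq_omega_coef _ _ _ _ (coef_family t) (coef_family t)).
rewrite /omega_coef big_mkcond /= !big_ord_recl big_ord0 /= /bump /=.
rewrite /= ?(mulr0n, mulr1n, mul0r, mulr0, mul0rz, addr0, add0r, mul1r, mulr1).
rewrite ?(addSn, add0n, addn0, subSS, subn0) omega_const_88817 omega_const_88871 omega_const_88844.
by ring.
Qed.

Lemma h_family t : h_coef (fun i => (family t)`_i) 2 = - 24%:R * kappa2 t ^+ 2.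
Proof.
rewrite /h_coef /omega_coef big_mkcond /= !big_ord_recl big_ord0 /= /bump /=.
rewrite !kappa_family //= ?(mul0r, mulr0, mul0rz, addr0, add0r) ?(addSn, add0n, addn0, subSS, subn0) omega_const_44222.
by ring.
Qed.

Lemma inv4_family t : inv4 (fun i => (family t)`_i) = 96%:R * kappa2 t ^+ 2.
Proof.
rewrite /inv4 /omega_coef big_mkcond /= !big_ord_recl big_ord0 /= /bump /=.
rewrite !kappa_family //= ?(mul0r, mulr0, mul0rz, addr0, add0r) ?(addSn, add0n, addn0, subSS, subn0) omega_const_44422.
by ring.
Qed.

Lemma inv6_family t : inv6 (fun i => (family t)`_i) = - (96%:R * 24%:R) * kappa2 t ^+ 3.
Proof.
rewrite /inv6 /omega_coef big_mkcond /= !big_ord_recl big_ord0 /= /bump /=.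
rewrite !kappa_family //= ?(mul0r, mulr0, mul0rz, addr0, add0r) ?(addSn, add0n, addn0, subSS, subn0) h_family omega_const_44422.
by ring.
Qed.

Lemma fact8 : 8`!%:R = 8%:R * (72%:R * 70%:R) :> k.
Proof. by rewrite !factS fact0 !natrM; ring. Qed.

Lemma fact4 : 4`!%:R = 24%:R :> k.
Proof. by []. Qed.

Lemma tnorm888 : tnorm k 8 8 8 = (8%:R * (72%:R * 70%:R)) ^- 2.
Proof. by rewrite /tnorm [in X in _ / X]natrM fact8 div1r expr2. Qed.

Lemma tnorm886 : tnorm k 8 8 6 = 4%:R * (8%:R * (72%:R * 70%:R)) ^- 2.
Proof. by rewrite /tnorm [in X in _ / X]natrM fact8 expr2. Qed.

Lemma tnorm442 : tnorm k 4 4 2 = 4%:R * 24%:R ^- 2.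
Proof. by rewrite /tnorm [in X in _ / X]natrM fact4 expr2. Qed.

Lemma tnorm444 : tnorm k 4 4 4 = 24%:R ^- 2.
Proof. by rewrite /tnorm [in X in _ / X]natrM fact4 div1r expr2. Qed.

Lemma J2_family t : J2 (octavic_of_poly (family t)) = t * (2%:R * t - 35%:R).
Proof.
rewrite binform_octavic J2_binform inv2_family /const2 tnorm888 !(natrM, natrX) -mulrA mulrCA.
apply: (canLR (mulKf _)); first by rewrite expf_neq0 // !mulf_neq0 ?natk_neq0.
by ring.
Qed.

(** The covariant kappa of the family is - t (8 t + 49) / 784 X^2 Z^2. *)
Let kappa_normalized t :
  2%:R ^+ 4 * 7%:R ^+ 2 * (tnorm k 8 8 6 * kappa2 t) = - (t * (8%:R * t + 49%:R)).
Proof.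
set D := (8%:R * (72%:R * 70%:R)) ^+ 2 : k.
have D0 : D != 0 by rewrite expf_neq0 // !mulf_neq0 ?natk_neq0.
have E : tnorm k 8 8 6 * D = 4%:R by rewrite tnorm886 mulfVK.
apply: (mulIf D0); transitivity (2%:R ^+ 4 * 7%:R ^+ 2 * (tnorm k 8 8 6 * D) * kappa2 t).
  by move: (tnorm k 8 8 6) (kappa2 t) D {E D0} => *; ring.
by rewrite E /kappa2 /D; ring.
Qed.

Let tnorm444K : 24%:R ^+ 2 * tnorm k 4 4 4 = 1.
Proof. by rewrite tnorm444 mulfV // expf_neq0 // natk_neq0. Qed.

Lemma J4_family t : J4 (octavic_of_poly (family t)) = t ^+ 2 * (8%:R * t + 49%:R) ^+ 2.
Proof.
rewrite binform_octavic J4_binform inv4_family /const4 !(natrM, natrX).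
have x := kappa_normalized t; have y := tnorm444K.
rewrite -exprMn -[RHS]sqrrN -x -[RHS]mul1r -[X in _ = X * _]y.
move: (tnorm k 8 8 6) (tnorm k 4 4 4) (kappa2 t) => *; ring.
Qed.

Lemma J6_family t : J6 (octavic_of_poly (family t)) = t ^+ 3 * (8%:R * t + 49%:R) ^+ 3.
Proof.
rewrite binform_octavic J6_binform inv6_family /const6 !(natrM, natrX).
have -> : tnorm k 4 4 2 = 4%:R * tnorm k 4 4 4 by rewrite tnorm442 tnorm444.
have x := kappa_normalized t; have y := tnorm444K.
rewrite -exprMn -[t * (_ + _)]opprK -x -[RHS]mul1r -[X in _ = X * _](expr1n _ 2) -[X in _ = X ^+ 2 * _]y.
move: (tnorm k 8 8 6) (tnorm k 4 4 4) (kappa2 t) => *; ring.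
Qed.
End FamilyInvariants.

(** * Dependence on the model, and the field of moduli *)

Section OctavicForms.
Variable k : closedFieldType.
Implicit Types (F G : {poly k}) (f g : {mpoly k[2]}).

(** Setting Z = 1 is injective on forms of degree 8, which reduces identities
between substituted forms to identities in one variable. *)
Definition dehomogenize : {mpoly k[2]} -> {poly k} :=
  mmap (@polyC k) (fun i : 'I_2 => if i == formX then 'X else 1).
HB.instance Definition _ := GRing.RMorphism.copy dehomogenize
  (mmap (@polyC k) (fun i : 'I_2 => if i == formX then 'X else 1)).

Lemma dehomogenizeZ c f : dehomogenize (c *: f) = c *: dehomogenize f.
Proof. by rewrite /dehomogenize mmapZ mul_polyC. Qed.

Lemma dehomogenizeX i : dehomogenize 'X_i = if i == formX then 'X else 1.
Proof. by rewrite /dehomogenize mmapX mmap1U. Qed.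

Lemma dehomogenize_binform (a : nat -> k) : dehomogenize (binform 8 a) = \poly_(i < 9) a i.
Proof.
rewrite poly_def rmorph_sum; apply: eq_bigr => i _ /=.
by rewrite dehomogenizeZ rmorphM !rmorphXn /= !dehomogenizeX /= expr1n mulr1.
Qed.

Lemma octavic_dehomogenize f : f \is 8.-homog -> octavic_of_poly (dehomogenize f) = f.
Proof.
move=> hf; rewrite [in LHS](homog_binform hf) dehomogenize_binform binform_octavic [RHS](homog_binform hf).
by apply: eq_bigr => i _; rewrite coef_poly ltn_ord.
Qed.

Lemma octavic_of_poly_homog F : octavic_of_poly F \is 8.-homog.
Proof.
rewrite binform_octavic; apply: rpred_sum => i _; apply: rpredZ.
have i8 : (i <= 8)%N by rewrite -ltnS.
have h (j : 'I_2) n : ('X_j : {mpoly k[2]}) ^+ n \is n.-homog.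
  by rewrite -[X in X.-homog]mul1n; apply: dhomogMn; rewrite dhomogX /= mdeg1.
by have := dhomogM (h formX i) (h formZ (8 - i)%N); rewrite subnKC.
Qed.

Lemma subst_octavic (M : 'M[k]_2) G : linear_subst M (octavic_of_poly G) =
  octavic_of_poly (form_subst G (M formX formX) (M formX formZ) (M formZ formX) (M formZ formZ)).
Proof.
rewrite -[LHS]octavic_dehomogenize; last exact: linear_subst_homog (octavic_of_poly_homog G).
congr octavic_of_poly; rewrite /octavic_of_poly /form_subst.
rewrite (_ : linear_subst M _ = \sum_(i < 9) linear_subst M (G`_i *: ('X_formX ^+ i * 'X_formZ ^+ (8 - i)))).
  rewrite rmorph_sum; apply: eq_bigr => i _ /=.
  rewrite linear_substZ dehomogenizeZ !rmorphM !rmorphXn /= !linear_substX !rmorphD /= !dehomogenizeZ !dehomogenizeX /=.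
  by rewrite -!alg_polyC.
exact: (rmorph_sum (linear_subst M)).
Qed.

Lemma octavicZ c F : octavic_of_poly (c *: F) = c *: octavic_of_poly F.
Proof. by rewrite /octavic_of_poly scaler_sumr; apply: eq_bigr => i _; rewrite coefZ scalerA. Qed.

Lemma J2Z c f : J2 (c *: f) = c ^+ 2 * J2 f.
Proof. by rewrite /J2 transvectantZ mcoeffZ expr2 mulrCA. Qed.
Lemma kappaZ c f : cov_kappa (c *: f) = c ^+ 2 *: cov_kappa f.
Proof. by rewrite /cov_kappa transvectantZ expr2. Qed.
Lemma J4Z c f : J4 (c *: f) = c ^+ 4 * J4 f.
Proof. by rewrite /J4 kappaZ transvectantZ mcoeffZ -exprD mulrCA. Qed.
Lemma cov_hZ c f : cov_h (c *: f) = c ^+ 4 *: cov_h f.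
Proof. by rewrite /cov_h kappaZ transvectantZ -exprD. Qed.
Lemma J6Z c f : J6 (c *: f) = c ^+ 6 * J6 f.
Proof. by rewrite /J6 kappaZ cov_hZ transvectantZ mcoeffZ -exprD mulrCA. Qed.

(** J6 and J2 J4 have the same degree and the same weight. *)
Lemma t4_form_subst F G a b c d lam : a * d - b * c != 0 -> lam != 0 ->
  form_subst G a b c d = lam *: F ->
  (J2 (octavic_of_poly F) * J4 (octavic_of_poly F) != 0) =
    (J2 (octavic_of_poly G) * J4 (octavic_of_poly G) != 0) /\
  t4_inv (octavic_of_poly F) = t4_inv (octavic_of_poly G).
Proof.
move=> det0 lam0 E.
pose M : 'M[k]_2 := \matrix_(i, j) if i == formX then if j == formX then a else b
   else if j == formX then c else d.
have detM : \det M != 0 by rewrite det_mx2 !mxE.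
have {}E : linear_subst M (octavic_of_poly G) = lam *: octavic_of_poly F.
  by rewrite subst_octavic !mxE /= E octavicZ.
move: (octavic_of_poly F) (octavic_of_poly G) E => f g E.
have := J2Z lam f; have := J4Z lam f; have := J6Z lam f.
rewrite -E J2_subst J4_subst J6_subst; move: (\det M) detM => D D0 E6 E4 E2.
have [u u0 uE] : exists2 u, u != 0 & lam ^+ 6 * u = D ^+ 24.
  exists (D ^+ 24 / lam ^+ 6); first by rewrite mulf_neq0 ?invr_eq0 ?expf_neq0.
  by rewrite mulrCA mulfV ?mulr1 ?expf_neq0.
have F24 : J2 f * J4 f = u * (J2 g * J4 g).
  apply: (mulfI (expf_neq0 6 lam0)); rewrite [RHS]mulrA uE.
  have -> : lam ^+ 6 * (J2 f * J4 f) = (lam ^+ 2 * J2 f) * (lam ^+ 4 * J4 f) by ring.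
  by rewrite -E2 -E4; ring.
have F6 : J6 f = u * J6 g.
  apply: (mulfI (expf_neq0 6 lam0)); rewrite [RHS]mulrA uE.
  exact: esym E6.
rewrite /t4_inv; move: (J2 f) (J4 f) (J6 f) (J2 g) (J4 g) (J6 g) F24 F6 => a2 a4 a6 b2 b4 b6 F24 F6.
rewrite F6 F24 mulf_eq0 (negPf u0) {E2 E4 E6 E}; split; first by [].
by rewrite -mulf_div divff // mul1r.
Qed.
End OctavicForms.

Section Moduli.
Variables (k : closedFieldType) (K : fieldType) (iota : {rmorphism k -> K}).
Hypothesis char0 : [pchar k] =i pred0.
Implicit Types (F G : {poly k}) (S : k -> Prop).

Lemma subfield_nat S n : is_subfield S -> S n%:R.
Proof.
case=> S1 SB _ _; have S0 : S 0 by rewrite -(subrr 1); apply: (SB).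
elim: n => // n Sn; have : S (n%:R - (0 - 1)) by apply: (SB) => //; apply: (SB).
by rewrite sub0r opprK natr1.
Qed.

Lemma subfield_div S a b : is_subfield S -> S a -> S b -> S (a / b).
Proof. by case=> _ _ SM SV Sa Sb; apply: (SM) => //; apply: (SV). Qed.

Lemma subfield_exp S a n : is_subfield S -> S a -> S (a ^+ n).
Proof.
move=> SS Sa; have [S1 _ SM _] := SS.
by elim: n => [|n IH]; rewrite ?expr0 // exprS; apply: (SM).
Qed.

Lemma subfield_add S a b : is_subfield S -> S a -> S b -> S (a + b).
Proof.
move=> SS Sa Sb; have [_ SB _ _] := SS; rewrite -[b]opprK; apply: (SB) => //.
by rewrite -sub0r; apply: (SB) => //; exact: (subfield_nat 0 SS).
Qed.

Lemma field_of_moduli_subfield : is_subfield (field_of_moduli iota).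
Proof.
split=> [S [] //|a b ha hb S SS Sv|a b ha hb S SS Sv|a ha S SS Sv]; have [_ SB SM SV] := SS.
- by apply: (SB); [exact: ha | exact: hb].
- by apply: (SM); [exact: ha | exact: hb].
- by apply: (SV); exact: ha.
Qed.

Lemma subfield_tnorm S m p n : is_subfield S -> S (tnorm k m p n).
Proof. by move=> SS; apply: subfield_div => //; apply: subfield_nat. Qed.

(** t4 is the rational number const6 / (const2 const4) times an absolute invariant
with integer coefficients. *)
Lemma t4_field_of_moduli F : genus3_model iota F ->
  J2 (octavic_of_poly F) * J4 (octavic_of_poly F) != 0 ->
  field_of_moduli iota (t4_inv (octavic_of_poly F)).
Proof.
move=> gF nz S SS Sv; have hF := octavic_of_poly_homog F.
have [e2 e4 e6] := octavic_eval_gen (octavic_of_poly F).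
set f := octavic_of_poly F in nz hF e2 e4 e6 *.
have E2 : J2 f = const2 k * octavic_eval (inv2 generic_coef) f.
  by rewrite e2 {1}(homog_binform hF); exact: J2_binform.
have E4 : J4 f = const4 k * octavic_eval (inv4 generic_coef) f.
  by rewrite e4 {1}(homog_binform hF); exact: J4_binform.
have E6 : J6 f = const6 k * octavic_eval (inv6 generic_coef) f.
  by rewrite e6 {1}(homog_binform hF); exact: J6_binform.
have E24 := octavic_evalM (inv2 generic_coef) (inv4 generic_coef) f.
have v24 : octavic_eval (inv2 generic_coef * inv4 generic_coef) f != 0.
  apply: contraNneq nz => E; rewrite E2 E4 mulrACA -E24 E mulr0; exact: eqxx.
have Sval : S (octavic_eval (inv6 generic_coef) f / octavic_eval (inv2 generic_coef * inv4 generic_coef) f).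
  apply: Sv; exists F, 6%N, (inv6 generic_coef), (inv2 generic_coef * inv4 generic_coef); split=> //.
    exact: octavic_invariant6.
  exact: octavic_invariant24.
have [_ _ SM _] := SS.
rewrite /t4_inv E6 E2 E4 mulrACA -E24 -mulf_div.
have Sn := @subfield_tnorm S _ _ _ SS; have SN n := @subfield_nat S n SS.
apply: (SM) => //; apply: subfield_div => //; rewrite /const2 /const4 /const6.
  apply: (SM _ _ (SN _)); apply: (SM) => //; apply: (SM) => //; exact: subfield_exp.
apply: (SM); apply: (SM _ _ (SN _)) => //; apply: (SM) => //; exact: subfield_exp.
Qed.

Lemma field_of_definition_family t : has_equation iota (double_cover (family t)) ->
  field_of_moduli iota t -> field_of_definition iota (field_of_moduli iota).
Proof.
move=> eqt St; split; first exact: field_of_moduli_subfield.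
exists (double_cover (family t)); split=> // i j.
have SS := field_of_moduli_subfield; move: (field_of_moduli iota) SS St => S SS St.
have Snat b : S b%:R := subfield_nat b SS.
have S0 := Snat 0; have [_ SB SM _] := SS.
have StM b : S (t *+ b) by rewrite -mulr_natr; apply: (SM).
rewrite coefB coef_map /= -polyC_exp coefC coef_family coefB coefC.
apply: (SB); first by case: (i == 0); rewrite ?coef0 // coefXn.
by case: (j == 0) => //; do !apply: subfield_add.
Qed.

End Moduli.

(** * Curves with dihedral automorphism group *)

Section Final.
Variables (k : closedFieldType) (K : fieldType) (iota : {rmorphism k -> K}).
Hypothesis char0 : [pchar k] =i pred0.
Local Notation is_model := (is_model iota).
Local Notation octavic_model := (octavic_model iota).
Implicit Types (F G : {poly k}).

Lemma genus3_octavic_model F : genus3_model iota F -> exists x y, octavic_model x y F.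
Proof.
case=> sepF szF /model_of_equation[x [y M]]; exists x, y; split=> //; split=> //.
by case/orP: szF => /eqP->.
Qed.

Section Dihedral.
Hypothesis autD12 : full_automorphism_group iota 'D_12.

Lemma automorphism_exponent6 (s : K -> K) : is_automorphism iota s -> forall z, iter 6 s z = z.
Proof.
have [phi [phiA phiS phiI phiM]] := autD12.
have phi1 z : phi 1%g z = z.
  have [[g gK _] _ _ _] := phiA 1%g; apply: (can_inj gK).
  by have := phiM 1%g 1%g z; rewrite mulg1 /= => <-.
have phiX a n z : phi (a ^+ n)%g z = iter n (phi a) z.
  elim: n => [|n IH] /=; first by rewrite expg0 phi1.
  by rewrite expgS phiM /= IH.
move=> /phiS[a sa] z; rewrite (eq_iter sa) -phiX dihedral12_elements.2.
exact: phi1.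
Qed.

(** For b nonzero the normal shape is a X^7 + b X^4 + a X; the substitution
X = m X' with m^3 = b / a makes the coefficients proportional to t, t and 1
with t = (b / a)^2. *)
Lemma exists_family : genus3_hyperelliptic iota ->
  exists w v t, t != 0 /\ octavic_model w v (family t).
Proof.
case=> F /genus3_octavic_model[x [y M]].
have [phi [phiA phiS phiI phiM]] := autD12.
have [[r [s [r3 r1 sr]]] _] := dihedral12_elements.
have [R Rr Rc] := auto_rmorph (phiA r); have [T Ts Tc] := auto_rmorph (phiA s).
have phi1 z : phi 1%g z = z.
  have [[g gK _] _ _ _] := phiA 1%g; apply: (can_inj gK).
  by have := phiM 1%g 1%g z; rewrite mulg1 /= => <-.
have Rbij : bijective R by apply: (eq_bij _ (fsym Rr)); case: (phiA r).
have Tbij : bijective T by apply: (eq_bij _ (fsym Ts)); case: (phiA s).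
have R3 z : R (R (R z)) = z.
  by rewrite !Rr; have := phiM r (r * r)%g z; rewrite r3 phi1 /= phiM /= => <-.
have R1 : ~ R =1 id.
  by move=> R1; apply: r1; apply: phiI => z; rewrite -Rr R1 phi1.
have TR z : T (R z) = R (R (T z)).
  by rewrite Ts !Rr Ts; have := phiM s r z; rewrite /= => <-; rewrite sr phiM /= phiM.
have [w [v [a [b [c [N a0 c0 bac]]]]]] := normal_shape char0 Rc Tc Rbij Tbij R3 R1 TR M.
have b0 : b != 0.
  apply/eqP=> b0; move: N.1; rewrite b0 scale0r addr0.
  exact: no_order12 char0 automorphism_exponent6 _ _ _ _.
have ca := bac b0; rewrite -{}ca in N.
(* X = m X' and Y = Y' / n, where m^3 = b / a and n^2 = 1 / (a m). *)
have [m mE] := closed_root_Xn (b / a) (isT : 0 < 3)%N.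
have m0 : m != 0 by apply: contra_eq_neq mE => ->; rewrite expr0n /= eq_sym mulf_neq0 ?invr_eq0.
have [n nE] := closed_root_Xn (a * m)^-1 (isT : 0 < 2)%N.
have n0 : n != 0 by apply: contra_eq_neq nE => ->; rewrite expr0n /= eq_sym invr_eq0 mulf_neq0.
have t0 : (b / a) ^+ 2 != 0 by rewrite expf_neq0 // mulf_neq0 ?invr_eq0.
exists (iota m^-1 * w), (iota n * v), ((b / a) ^+ 2); split=> //.
have N' : is_model (iota m^-1 * w) (iota n * v) (family ((b / a) ^+ 2)).
  apply: model_scale N.1 _ n0 _; first by rewrite invr_eq0.
  rewrite ev_family -[iota n ^+ 2]rmorphXn nE -mE !rmorphD /= !evZ !rmorphXn /= evX.
  have -> : iota b = iota m ^+ 3 * iota a by rewrite -rmorphXn mE fmorph_div divfK ?fmorph_eq0.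
  rewrite !fmorphV rmorphM /=.
  by field; rewrite !fmorph_eq0 a0 m0.
split=> //; have [sF _] := M.2; apply: (model_squarefree char0 M.1 M.2 N').
by rewrite size_family.
Qed.

End Dihedral.
End Final.

Theorem lemma8 (k : closedFieldType) (char0 : [pchar k] =i pred0)
    (K : fieldType) (iota : {rmorphism k -> K})
    (genus3 : genus3_hyperelliptic iota)
    (autD12 : full_automorphism_group iota 'D_12) :
  let family (t : k) : {poly k} := 'X * (t *: 'X^6 + t *: 'X^3 + 1) in
  (exists t : k,
     [/\ t != 0, t != 4 & has_equation iota (double_cover (family t))]) /\
  (forall t : k,
     t != 0 -> t != 4 -> has_equation iota (double_cover (family t)) ->
     t != 35 / 2 -> t != - (245 / 4) ->
     (forall F : {poly k}, genus3_model iota F ->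
        let f := octavic_of_poly F in
        [/\ J2 f * J4 f != 0, t4_inv f != 4
          & t = 7 / 2 * ((5 * t4_inv f + 7) / (t4_inv f - 4))]) /\
     field_of_definition iota (field_of_moduli iota)).
Proof.
move=> fam; split.
  have [w [v [t [t0 M]]]] := exists_family char0 autD12 genus3.
  exists t; split=> //; first exact: octavic_model_family_neq4 char0 _ _ _ M.
  exact: equation_of_model M.1.
move=> t t0 t4 eqt t35 _; have [w [v M]] := model_of_equation eqt.
have n2 : 2%:R != 0 :> k by apply: natr_neq0.
have d35 : 2%:R * t - 35%:R != 0.
  apply: contra t35; rewrite subr_eq0 => /eqP E; apply/eqP/(canRL (mulfK n2)).
  by rewrite mulrC.
have invF F : genus3_model iota F -> let f := octavic_of_poly F in
   J2 f * J4 f != 0 /\ t4_inv f = (8%:R * t + 49%:R) / (2%:R * t - 35%:R).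
  move=> /genus3_octavic_model[x [y N]] /=.
  have szf : (size (family t) <= 9)%N by rewrite size_family.
  have [sepF /andP[szF _]] := N.2.
  have d49 : 8%:R * t + 49%:R != 0.
    apply/eqP; apply: (no_cube char0 (automorphism_exponent6 autD12)).
    by split; [exact: M | exact: (model_squarefree char0 N.1 N.2 M szf)].
  have [a [b [c [d [lam [det0 lam0 _ _ E]]]]]] := model_transport char0 N.1 sepF szF M szf.
  have [-> ->] := t4_form_subst det0 lam0 E.
  rewrite /t4_inv J2_family // J4_family // J6_family //; split.
    by rewrite !mulf_neq0 ?expf_neq0.
  by field; rewrite t0 d35 d49.
have t4E F : genus3_model iota F -> let f := octavic_of_poly F in
   t4_inv f != 4 /\ t = 7 / 2 * ((5 * t4_inv f + 7) / (t4_inv f - 4)).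
  move=> gF /=; have [_ /= ->] := invF F gF; set u := (8%:R * t + 49%:R) / _.
  (* 8 t + 49 - 4 (2 t - 35) = 189. *)
  have u4 : u - 4%:R = 189%:R / (2%:R * t - 35%:R) by rewrite /u; field.
  have u4' : u - 4%:R != 0 by rewrite u4 mulf_neq0 ?invr_eq0 ?natr_neq0.
  split; first by rewrite -subr_eq0.
  by rewrite u4 /u; field; rewrite n2 d35 natr_neq0.
split.
  by move=> F gF f; have [? ?] := invF F gF; have [? ?] := t4E F gF.
have [F gF] := genus3; have [nz _] := invF F gF; have [_ tE] := t4E F gF.
apply: (field_of_definition_family eqt) => S SS Sv.
have St4 := t4_field_of_moduli char0 gF nz SS Sv.
have [_ SB SM _] := SS; have Sn n := subfield_nat n SS.
rewrite tE; apply: (SM); first exact: subfield_div.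
by apply: subfield_div => //; [apply: subfield_add => //; apply: (SM) | apply: (SB)].
Qed.
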